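(* Let $u$ be a nonconstant inner function and let $\varphi\in L^\infty(\mathbb{T})$ with $\|\varphi\|_\infty=1$. Then the following are equivalent: (1) There exist inner functions $\psi_-$ and $\chi_-$ such that $\varphi=u\,\psi_-\,\overline{\chi_-}$ a.e. on $\mathbb{T}$. (2) There exists a nonzero $y_0\in H^2_-$ such that the vector $f_0:=0\oplus y_0\in uH^2\oplus H^2_-=\mathcal{K}_u^\perp$ is extremal for $D_\varphi$, that is, $\|D_\varphi f_0\|=\|f_0\|$, and moreover $\varphi\,\overline{u}\,y_0\in H^2_-$.
   Context: $\mathbb{T}$ is the unit circle with normalized arc-length measure $m$, $L^2=L^2(\mathbb{T})$, $L^\infty=L^\infty(\mathbb{T})$. $H^2\subset L^2$ is the Hardy space of functions whose Fourier coefficients of negative index vanish, $H^2_-=L^2\ominus H^2$, and $H^\infty=H^2\cap L^\infty$. An inner function is a $u\in H^\infty$ with $|u|=1$ a.e. on $\mathbb{T}$. The model space is $\mathcal{K}_u=H^2\ominus uH^2$; its orthogonal complement in $L^2$ is $\mathcal{K}_u^\perp=uH^2\oplus H^2_-$, and $x\oplus y$ (with $x\in uH^2$, $y\in H^2_-$) is identified with $x+y\in L^2$. $P_{\mathcal{K}_u}$ is the orthogonal projection of $L^2$ onto $\mathcal{K}_u$. The dual truncated Toeplitz operator with symbol $\varphi\in L^\infty$ is $D_\varphi:\mathcal{K}_u^\perp\to\mathcal{K}_u^\perp$, $D_\varphi h=(I-P_{\mathcal{K}_u})(\varphi h)$. One has $\|D_\varphi\|=\|\varphi\|_\infty$. 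*)

(* Defs.v *)
From HB Require Import structures.
From mathcomp Require Import all_boot all_order all_algebra.
From mathcomp Require Import all_classical all_reals all_analysis.
From mathcomp Require Import complex.

Set Implicit Arguments.
Unset Strict Implicit.
Unset Printing Implicit Defensive.

Import Order.TTheory GRing.Theory Num.Theory.
Import Normc.

Local Open Scope classical_set_scope.
Local Open Scope ring_scope.
Local Open Scope complex_scope.

Section circle_measure.
Variable R : realType.

Definition circle : Type := {z : R[i] | normc z == 1}.

Fact expi_subproof (t : R) : normc (cos t +i* sin t) == 1.
Proof. by rewrite /normc cos2Dsin2 sqrtr1. Qed.

Definition expi (t : measurableTypeR R) : circle := exist _ (cos t +i* sin t) (expi_subproof t).

HB.instance Definition _ := SubChoice.on circle.
HB.instance Definition _ := isPointed.Build circle (expi 0).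

(* Since [expi] is continuous, 2 pi-periodic and restricts to a Borel
   isomorphism from [0, 2 pi[ onto the circle, these are exactly the Borel
   subsets of the circle. *)
Definition circle_measurable : set (set circle) :=
  [set A | measurable (expi @^-1` A)].

Let circle_measurable0 : circle_measurable set0.
Proof. by rewrite /circle_measurable /= preimage_set0. Qed.

Let circle_measurableC A : circle_measurable A -> circle_measurable (~` A).
Proof. by rewrite /circle_measurable /= -preimage_setC; exact: measurableC. Qed.

Let circle_measurableU (F : (set circle)^nat) :
  (forall n, circle_measurable (F n)) -> circle_measurable (\bigcup_n F n).
Proof.
by move=> mF; rewrite /circle_measurable /= preimage_bigcup; exact: bigcupT_measurable.
Qed.

HB.instance Definition _ := @isMeasurable.Build default_measure_display circle
  circle_measurable circle_measurable0 circle_measurableC circle_measurableU.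

Lemma measurable_expi : measurable_fun [set: measurableTypeR R] expi.
Proof. by move=> _ A mA; rewrite setTI. Qed.

HB.instance Definition _ :=
  isMeasurableFun.Build _ _ _ _ expi measurable_expi.

Fact twopi_gt0 : 0 < 2 * pi :> R.
Proof. by rewrite mulr_gt0 ?pi_gt0. Qed.

(* Normalized arc length: the law of [expi t] for t uniform in [0, 2 pi]. *)
Definition arclength : {measure set circle -> \bar R} :=
  distribution (uniform_prob twopi_gt0)
    (expi : {mfun measurableTypeR R >-> circle}).

End circle_measure.

Section function_spaces.
Variable R : realType.
Local Notation T := (circle R).
Local Notation m := (@arclength R).
Implicit Types (f g h u phi : T -> R[i]) (V W : set (T -> R[i])).

(* Elements of L^2 and L^oo are represented by functions, so that equality
   of elements is [aeeq]. *)
Definition aeeq f g : Prop := {ae m, forall z, f z = g z}.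

Definition cmeasurable f : Prop :=
  measurable_fun setT (fun z => complex.Re (f z)) /\
  measurable_fun setT (fun z => complex.Im (f z)).

Definition cLnorm (p : \bar R) f : \bar R :=
  ('N[m]_p[EFin \o (fun z => normc (f z))])%E.

Definition L2 : set (T -> R[i]) :=
  [set f | cmeasurable f /\ (cLnorm 2%:E f < +oo)%E].

Definition Loo : set (T -> R[i]) :=
  [set f | cmeasurable f /\ (cLnorm +oo%E f < +oo)%E].

Definition cintegral f : R[i] :=
  Rintegral m setT (fun z => complex.Re (f z)) +i* Rintegral m setT (fun z => complex.Im (f z)).

Definition inner_prod f g : R[i] := cintegral (fun z => f z * conjc (g z)).

Definition fourier f (n : int) : R[i] :=
  cintegral (fun z => f z * conjc (sval z ^ n)).

Definition ominus V W : set (T -> R[i]) :=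
  [set f | V f /\ forall g, W g -> inner_prod f g = 0].

Definition H2 : set (T -> R[i]) :=
  [set f | L2 f /\ forall n : int, n < 0 -> fourier f n = 0].

Definition H2minus : set (T -> R[i]) := ominus L2 H2.

Definition Hoo : set (T -> R[i]) := H2 `&` Loo.

Definition is_inner u : Prop := Hoo u /\ {ae m, forall z, normc (u z) = 1}.

Definition nonconstant u : Prop := ~ exists c : R[i], aeeq u (cst c).

Definition uH2 u : set (T -> R[i]) := [set (fun z => u z * g z) | g in H2].

Definition model_space u : set (T -> R[i]) := ominus H2 (uH2 u).

Definition model_perp u : set (T -> R[i]) := ominus L2 (model_space u).

Definition orth_proj_of V f p : Prop :=
  V p /\ forall g, V g -> inner_prod (fun z => f z - p z) g = 0.

(* For a closed subspace V of L^2 and f in L^2 the projection exists and is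
   unique up to [aeeq]; [xget] picks a representative of it. *)
Definition orth_proj V f : T -> R[i] := xget (cst 0) [set p | orth_proj_of V f p].

Definition dual_toeplitz u phi h : T -> R[i] :=
  fun z => phi z * h z - orth_proj (model_space u) (fun w => phi w * h w) z.

(* The element x (+) y of u H^2 (+) H^2_- as an element of L^2. *)
Definition osum f g : T -> R[i] := fun z => f z + g z.

(* The domain of D_phi is [model_perp u]. The norm equality is extremality for
   symbols with ||D_phi|| = ||phi||_oo = 1. *)
Definition extremal u phi h : Prop :=
  model_perp u h /\
  cLnorm 2%:E (dual_toeplitz u phi h) = cLnorm 2%:E h.

End function_spaces.

(* Main.v *)
Require Import Defs.
From HB Require Import structures.
From mathcomp Require Import all_boot all_order all_algebra.
From mathcomp Require Import all_classical all_reals all_analysis.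
From mathcomp Require Import measurable_realfun ess_sup_inf complex ring lra zify.

Set Implicit Arguments.
Unset Strict Implicit.
Unset Printing Implicit Defensive.

Import Order.TTheory GRing.Theory Num.Theory numFieldNormedType.Exports.

Local Open Scope classical_set_scope.
Local Open Scope ring_scope.
Local Open Scope complex_scope.

(** Condition (2) does not see the factor u of condition (1): since
    u psi conj(chi) = (u psi) conj(chi) and theta conj(chi) =
    u theta conj(u chi), condition (1) says that phi is a quotient
    theta conj(chi) of inner functions.

    From (1) to (2) one can take y0 = conj(z u psi). Then
    phi y0 = conj(z chi) and phi conj(u) y0 = conj(z u chi). The reflection
    f |-> conj(z f) maps H^2 onto its complement ([H2minus_of_H2]), so all three
    functions are orthogonal to H^2; in particular phi y0 has no component in
    the model space and D_phi y0 = phi y0 has the norm of y0.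

    From (2) to (1), extremality forces phi y0 to be orthogonal to the model
    space and |phi| = 1 wherever y0 is not zero ([extremal_contraction]).
    The condition on phi conj(u) y0 says that phi y0 is also orthogonal to u H^2,
    hence to H^2 ([H2minus_of_orthogonal]). After reflection, w = conj(z y0) is a
    nonzero function of H^2 such that conj(phi) w is in H^2 and w vanishes where
    |phi| < 1. Such functions w form a closed subspace of H^2 stable under
    multiplication by z; by Beurling's argument ([shift_invariant_inner]) it
    contains an inner function theta, and chi = conj(phi) theta is then inner
    ([inner_quotient]); |phi| = 1 almost everywhere because theta, which vanishes
    nowhere, belongs to that subspace.

    Two analytic facts carry this. Orthogonal projections onto closed subspaces
    of L^2 exist ([orth_proj_exists]), by completeness. An integrable function
    without Fourier coefficients vanishes ([fourier0_ae]): it is orthogonal to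
    all trigonometric polynomials, which approximate the indicators of arcs, so
    its primitive in the angle is constant. Together they give the product rule
    in H^2 ([H2_product]) and the constant modulus in Beurling's argument. *)

(** * Complex-valued functions and integrals on the circle *)

Section complex_integral.
Context {R : realType}.
Local Notation T := (circle R).
Local Notation m := (@arclength R).
Local Notation Re := (@complex.Re R).
Local Notation Im := (@complex.Im R).
Implicit Types (f g h : T -> R[i]) (x y : R[i]).

Lemma Re_add x y : Re (x + y) = Re x + Re y.
Proof. by case: x; case: y. Qed.
Lemma Im_add x y : Im (x + y) = Im x + Im y.
Proof. by case: x; case: y. Qed.
Lemma Re_opp x : Re (- x) = - Re x.
Proof. by case: x. Qed.
Lemma Im_opp x : Im (- x) = - Im x.
Proof. by case: x. Qed.
Lemma Re_mul x y : Re (x * y) = Re x * Re y - Im x * Im y.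
Proof. by case: x; case: y. Qed.
Lemma Im_mul x y : Im (x * y) = Re x * Im y + Im x * Re y.
Proof. by case: x; case: y. Qed.
Lemma Re_conj x : Re (conjc x) = Re x.
Proof. by case: x. Qed.
Lemma Im_conj x : Im (conjc x) = - Im x.
Proof. by case: x. Qed.

Definition ReImE := (Re_add, Im_add, Re_opp, Im_opp, Re_mul, Im_mul, Re_conj, Im_conj).

Lemma complex_eqP x y : Re x = Re y -> Im x = Im y -> x = y.
Proof. by case: x => a b; case: y => c d /= -> ->. Qed.

Definition sqmod x : R := Re x ^+ 2 + Im x ^+ 2.

Lemma normc_sqrt x : Normc.normc x = Num.sqrt (sqmod x).
Proof. by case: x. Qed.

Lemma sqmod_ge0 x : 0 <= sqmod x.
Proof. by rewrite addr_ge0// sqr_ge0. Qed.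

Lemma normc_ge0 x : 0 <= Normc.normc x.
Proof. by rewrite normc_sqrt sqrtr_ge0. Qed.

Lemma normc_sqr x : Normc.normc x ^+ 2 = sqmod x.
Proof. by rewrite normc_sqrt sqr_sqrtr// sqmod_ge0. Qed.

Lemma sqmod_eq0 x : (sqmod x == 0) = (x == 0).
Proof.
by case: x => a b; rewrite /sqmod paddr_eq0 ?sqr_ge0//= !sqrf_eq0 eq_complex.
Qed.

Lemma sqmodM x y : sqmod (x * y) = sqmod x * sqmod y.
Proof. by rewrite /sqmod !ReImE; ring. Qed.

Lemma sqmodJ x : sqmod (conjc x) = sqmod x.
Proof. by rewrite /sqmod !ReImE; ring. Qed.

Lemma mul_conjc x : x * conjc x = (sqmod x)%:C.
Proof. by apply: complex_eqP; rewrite /sqmod !ReImE/=; ring. Qed.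

Lemma normc_eq1 x : (Normc.normc x = 1) <-> (sqmod x = 1).
Proof.
split=> [h|h]; first by rewrite -normc_sqr h expr1n.
by rewrite normc_sqrt h sqrtr1.
Qed.

Lemma sqmod_circle (z : T) : sqmod (sval z) = 1.
Proof. by apply/normc_eq1/eqP; exact: (svalP z). Qed.

Definition cintegrable f : Prop :=
  m.-integrable setT (EFin \o (fun z => Re (f z))) /\
  m.-integrable setT (EFin \o (fun z => Im (f z))).

Lemma cintegrable_measurable f : cintegrable f -> cmeasurable f.
Proof.
by case=> /integrableP[mf _] /integrableP[mg _]; split; apply/measurable_EFinP.
Qed.

Lemma cmeasurableD f g : cmeasurable f -> cmeasurable g ->
  cmeasurable (fun z => f z + g z).
Proof.
move=> [f1 f2] [g1 g2]; split.
  by under eq_fun do rewrite Re_add; exact: measurable_funD.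
by under eq_fun do rewrite Im_add; exact: measurable_funD.
Qed.

Lemma cmeasurableN f : cmeasurable f -> cmeasurable (fun z => - f z).
Proof.
move=> [f1 f2]; split.
  by under eq_fun do rewrite Re_opp; exact: measurableT_comp.
by under eq_fun do rewrite Im_opp; exact: measurableT_comp.
Qed.

Lemma cmeasurableB f g : cmeasurable f -> cmeasurable g ->
  cmeasurable (fun z => f z - g z).
Proof. by move=> mf mg; apply: cmeasurableD => //; exact: cmeasurableN. Qed.

Lemma cmeasurableM f g : cmeasurable f -> cmeasurable g ->
  cmeasurable (fun z => f z * g z).
Proof.
move=> [f1 f2] [g1 g2]; split.
  under eq_fun do rewrite Re_mul.
  by apply: measurable_funB; exact: measurable_funM.
under eq_fun do rewrite Im_mul.
by apply: measurable_funD; exact: measurable_funM.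
Qed.

Lemma cmeasurableJ f : cmeasurable f -> cmeasurable (fun z => conjc (f z)).
Proof.
move=> [f1 f2]; split; first by under eq_fun do rewrite Re_conj.
by under eq_fun do rewrite Im_conj; exact: measurableT_comp.
Qed.

Lemma cmeasurable_cst (c : R[i]) : cmeasurable (fun=> c : R[i]).
Proof. by split; exact: measurable_cst. Qed.

Lemma measurable_sqmod f : cmeasurable f ->
  measurable_fun setT (fun z => sqmod (f z)).
Proof. by move=> [f1 f2]; apply: measurable_funD; apply: measurable_funX. Qed.

(** The Borel sets of the circle are those whose preimage by expi is Borel, so
    measurability can be tested in the angle. *)
Lemma measurable_circle (g : T -> R) :
  measurable_fun setT (g \o @expi R) -> measurable_fun setT g.
Proof. by move=> mg _ B mB; rewrite setTI; have := mg measurableT B mB; rewrite setTI. Qed.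

Lemma cmeasurable_id : cmeasurable (fun z : T => sval z).
Proof.
split; apply: measurable_circle.
  by apply: (@continuous_measurable_fun R cos); exact: continuous_cos.
by apply: (@continuous_measurable_fun R sin); exact: continuous_sin.
Qed.

Lemma circle_neq0 (z : T) : sval z != 0.
Proof. by rewrite -sqmod_eq0 sqmod_circle oner_eq0. Qed.

Lemma conj_circle (z : T) : conjc (sval z) = (sval z)^-1.
Proof.
apply: (mulfI (circle_neq0 z)).
by rewrite mul_conjc sqmod_circle mulfV// circle_neq0.
Qed.

Lemma conj_circleX (z : T) (n : int) : conjc (sval z ^ n) = sval z ^ (- n).
Proof.
rewrite -exprz_inv -conj_circle; case: n => n; first by rewrite -!exprnP rmorphXn.
by rewrite !NegzE -!exprnN rmorphV ?rmorphXn// unitfE expf_neq0// circle_neq0.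
Qed.

Lemma circleXD (z : T) (n k : int) : sval z ^ (n + k) = sval z ^ n * sval z ^ k.
Proof. by rewrite expfzDr// circle_neq0. Qed.

Lemma sqmod_circleX (z : T) (n : int) : sqmod (sval z ^ n) = 1.
Proof.
have /(congr1 Re) := mul_conjc (sval z ^ n).
by rewrite conj_circleX -circleXD subrr expr0z.
Qed.

Lemma cmeasurable_circleX (n : int) : cmeasurable (fun z : T => sval z ^ n).
Proof.
have H k : cmeasurable (fun z : T => sval z ^+ k).
  elim: k => [|k ih]; first exact: cmeasurable_cst.
  by under eq_fun do rewrite exprS; apply: cmeasurableM => //; exact: cmeasurable_id.
case: n => n; first exact: H.
under eq_fun do rewrite -[Negz n]opprK -conj_circleX NegzE opprK.
exact/cmeasurableJ/H.
Qed.

Lemma arclength_setT : m setT = 1%E.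
Proof. by rewrite /arclength; exact: probability_setT. Qed.

(** The whole circle is not negligible. *)
Lemma ae_constant (P : Prop) : {ae m, forall z, P} -> P.
Proof.
move=> h; apply: contrapT => nP.
have /negligibleP : m.-negligible setT.
  by apply: negligibleS h => z _ /=.
by move=> /(_ measurableT) /(etrans (esym arclength_setT)) /eqP; rewrite onee_eq0.
Qed.

Lemma rintegrable_le_ae (g h : T -> R) : measurable_fun setT g ->
  m.-integrable setT (EFin \o h) -> {ae m, forall z, `|g z| <= h z} ->
  m.-integrable setT (EFin \o g).
Proof.
move=> mg ih gh; apply/integrableP; split; first exact/measurable_EFinP.
have /integrableP[mh] := ih; apply: le_lt_trans.
apply: ae_ge0_le_integral => //.
- by apply: measurableT_comp => //; exact/measurable_EFinP.
- by apply: measurableT_comp => //; exact/measurable_EFinP.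
- by apply: filterS gh => z gh _ /=; rewrite lee_fin (le_trans gh)// ler_norm.
Qed.

Lemma rintegrable_le (g h : T -> R) : measurable_fun setT g ->
  m.-integrable setT (EFin \o h) -> (forall z, `|g z| <= h z) ->
  m.-integrable setT (EFin \o g).
Proof. by move=> mg ih gh; apply: (rintegrable_le_ae mg ih); exact: aeW. Qed.

Lemma rintegrable_cst (c : R) : m.-integrable setT (EFin \o (fun=> c)).
Proof.
apply: measurable_bounded_integrable => //.
  by apply: (@le_lt_trans _ _ 1%E); rewrite ?ltry// -arclength_setT.
by exists `|c|; split; [exact: num_real|move=> x cx z _; exact: ltW].
Qed.

Lemma rintegrableD (g h : T -> R) : m.-integrable setT (EFin \o g) ->
  m.-integrable setT (EFin \o h) ->
  m.-integrable setT (EFin \o (fun z => g z + h z)).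
Proof. by move=> ig ih; have := integrableD measurableT ig ih. Qed.

Lemma rintegrableN (g : T -> R) : m.-integrable setT (EFin \o g) ->
  m.-integrable setT (EFin \o (fun z => - g z)).
Proof. by move=> ig; have := integrableN ig. Qed.

Lemma rintegrableZ (c : R) (g : T -> R) : m.-integrable setT (EFin \o g) ->
  m.-integrable setT (EFin \o (fun z => c * g z)).
Proof. by move=> ig; have := integrableZl measurableT c ig. Qed.

Lemma rintegral_cst (c : R) : \int[m]_z c = c.
Proof. by rewrite Rintegral_cst// (congr1 fine arclength_setT) mulr1. Qed.

Lemma rintegral_ae (g h : T -> R) : measurable_fun setT g -> measurable_fun setT h ->
  {ae m, forall z, g z = h z} -> \int[m]_z g z = \int[m]_z h z.
Proof.
move=> mg mh gh; congr fine; apply: ae_eq_integral => //.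
- exact/measurable_EFinP.
- exact/measurable_EFinP.
- by apply: filterS gh => z gh _ /=; rewrite gh.
Qed.

Lemma ae_le_rintegral (g h : T -> R) : m.-integrable setT (EFin \o g) ->
  m.-integrable setT (EFin \o h) -> {ae m, forall z, g z <= h z} ->
  \int[m]_z g z <= \int[m]_z h z.
Proof.
move=> ig ih gh; rewrite -subr_ge0 -RintegralB//.
rewrite (@rintegral_ae _ (fun z => `|h z - g z|)); first exact: Rintegral_ge0.
- by apply: measurable_funB; apply/measurable_EFinP;
    [case/integrableP: ih|case/integrableP: ig].
- apply: measurableT_comp => //.
  by apply: measurable_funB; apply/measurable_EFinP;
    [case/integrableP: ih|case/integrableP: ig].
- by apply: filterS gh => z gh; rewrite ger0_norm// subr_ge0.
Qed.

(** Equality cases of norm inequalities become pointwise statements through this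
    lemma. *)
Lemma rintegral_eq0_ae (g : T -> R) : m.-integrable setT (EFin \o g) ->
  {ae m, forall z, 0 <= g z} -> \int[m]_z g z = 0 -> {ae m, forall z, g z = 0}.
Proof.
move=> ig g0 ig0.
have mg : measurable_fun setT g by apply/measurable_EFinP; case/integrableP: ig.
have ag0 : (\int[m]_z `|(g z)%:E| = 0)%E.
  have ian : m.-integrable setT (EFin \o (fun z => `|g z|)) by exact: integrable_norm.
  rewrite -[LHS]fineK; last exact: (integrable_fin_num _ ian).
  congr EFin; rewrite -[RHS]ig0; apply: rintegral_ae => //.
    exact: measurableT_comp.
  by apply: filterS g0 => z g0; rewrite /= ger0_norm.
have /= := (ae_eq_integral_abs m measurableT (proj2 (measurable_EFinP _ _) mg)).1 ag0.
by apply: filterS => z /(_ I) [].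
Qed.

Lemma cintegrableD f g : cintegrable f -> cintegrable g ->
  cintegrable (fun z => f z + g z).
Proof.
move=> [f1 f2] [g1 g2]; split.
  by under [X in EFin \o X]eq_fun do rewrite Re_add; exact: rintegrableD.
by under [X in EFin \o X]eq_fun do rewrite Im_add; exact: rintegrableD.
Qed.

Lemma cintegrableZ (c : R[i]) f : cintegrable f -> cintegrable (fun z => c * f z).
Proof.
move=> [f1 f2]; split.
  under [X in EFin \o X]eq_fun do rewrite Re_mul.
  by apply: rintegrableD; [|apply: rintegrableN]; exact: rintegrableZ.
under [X in EFin \o X]eq_fun do rewrite Im_mul.
by apply: rintegrableD; exact: rintegrableZ.
Qed.

Lemma cintegrableN f : cintegrable f -> cintegrable (fun z => - f z).
Proof. by move=> /(cintegrableZ (-1)); under eq_fun do rewrite mulN1r. Qed.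

Lemma cintegrableB f g : cintegrable f -> cintegrable g ->
  cintegrable (fun z => f z - g z).
Proof. by move=> cf cg; apply: cintegrableD => //; exact: cintegrableN. Qed.

Lemma cintegrable_cst (c : R[i]) : cintegrable (fun=> c).
Proof. by split; exact: rintegrable_cst. Qed.

Lemma cintegral_cst (c : R[i]) : cintegral (fun=> c) = c.
Proof. by apply: complex_eqP; rewrite /= rintegral_cst. Qed.

Lemma cintegralD f g : cintegrable f -> cintegrable g ->
  cintegral (fun z => f z + g z) = cintegral f + cintegral g.
Proof.
move=> [f1 f2] [g1 g2]; apply: complex_eqP; rewrite ReImE /= -RintegralD//;
  by apply: eq_Rintegral => z _; rewrite ReImE.
Qed.

Lemma cintegralZ (c : R[i]) f : cintegrable f ->
  cintegral (fun z => c * f z) = c * cintegral f.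
Proof.
move=> [f1 f2]; apply: complex_eqP; rewrite ReImE /= -!RintegralZl//.
  rewrite -RintegralB//; [|exact: rintegrableZ..].
  by apply: eq_Rintegral => z _; rewrite ReImE.
rewrite -RintegralD//; [|exact: rintegrableZ..].
by apply: eq_Rintegral => z _; rewrite ReImE.
Qed.

Lemma cintegralB f g : cintegrable f -> cintegrable g ->
  cintegral (fun z => f z - g z) = cintegral f - cintegral g.
Proof.
move=> cf cg; rewrite cintegralD//; last exact: cintegrableN.
by rewrite -[- cintegral g]mulN1r -cintegralZ//; under [in RHS]eq_fun do rewrite mulN1r.
Qed.

Lemma cintegralJ f : cintegrable f ->
  cintegral (fun z => conjc (f z)) = conjc (cintegral f).
Proof.
move=> [f1 f2]; apply: complex_eqP; rewrite ReImE /=.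
  by apply: eq_Rintegral => z _; rewrite ReImE.
rewrite -[RHS]mulN1r -RintegralZl//.
by apply: eq_Rintegral => z _; rewrite ReImE mulN1r.
Qed.

Lemma cintegral_ae f g : cmeasurable f -> cmeasurable g -> aeeq f g ->
  cintegral f = cintegral g.
Proof.
move=> [f1 f2] [g1 g2] fg; apply: complex_eqP; apply: rintegral_ae => //;
  by apply: filterS fg => z /= ->.
Qed.

Lemma cintegrableM f g : cintegrable f -> cmeasurable g ->
  (forall z, sqmod (g z) <= 1) -> cintegrable (fun z => f z * g z).
Proof.
move=> cf mg g1; have [f1 f2] := cf.
have [m1 m2] := cmeasurableM (cintegrable_measurable cf) mg.
have iN := rintegrableD (integrable_norm f1) (integrable_norm f2).
have bd (a b c d : R) : c ^+ 2 + d ^+ 2 <= 1 -> `|a * c| + `|b * d| <= `|a| + `|b|.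
  move=> cd; rewrite !normrM; apply: lerD; rewrite ler_piMr// ler_norml;
    by apply/andP; split; have := sqr_ge0 c; have := sqr_ge0 d; nra.
split; [apply: (rintegrable_le m1 iN)|apply: (rintegrable_le m2 iN)] => z;
  rewrite ReImE.
  by apply: le_trans (ler_normB _ _) _; exact/bd/g1.
apply: le_trans (ler_normD _ _) _; apply: bd.
by rewrite addrC; exact: g1.
Qed.

(** * Square-integrable functions *)

Definition sqnorm f : R := \int[m]_z sqmod (f z).

Lemma Lnorm2E f : cLnorm 2%:E f =
  ((\int[m]_z (sqmod (f z))%:E) `^ 2^-1)%E.
Proof.
rewrite /cLnorm unlock /=; congr (_ `^ _)%E.
apply: eq_integral => z _ /=.
by rewrite ger0_norm ?normc_ge0// powR_mulrn ?normc_ge0// normc_sqr.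
Qed.

Lemma L2P f : L2 f <->
  cmeasurable f /\ m.-integrable setT (EFin \o (fun z => sqmod (f z))).
Proof.
rewrite /L2 /=; split=> -[mf h]; split=> //.
  apply/integrableP; split; first by apply/measurable_EFinP; exact: (measurable_sqmod mf).
  under eq_integral do rewrite /= ger0_norm ?sqmod_ge0//.
  move: h; rewrite Lnorm2E; apply: lty_poweRy.
  by rewrite invr_neq0.
case/integrableP: h => _ h; rewrite Lnorm2E.
apply: poweR_lty; apply: le_lt_trans h.
by under [leRHS]eq_integral do rewrite /= ger0_norm ?sqmod_ge0//.
Qed.

Lemma L2_cmeasurable f : L2 f -> cmeasurable f.
Proof. by case. Qed.

Lemma L2_integrable f : L2 f -> m.-integrable setT (EFin \o (fun z => sqmod (f z))).
Proof. by move=> /L2P[]. Qed.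

Lemma L2_cst (c : R[i]) : L2 ((fun=> c) : T -> R[i]).
Proof. by apply/L2P; split; [exact: cmeasurable_cst|exact: rintegrable_cst]. Qed.

Lemma L2_le_ae f g : L2 f -> cmeasurable g ->
  {ae m, forall z, sqmod (g z) <= sqmod (f z)} -> L2 g.
Proof.
move=> /L2P[mf sf] mg gf; apply/L2P; split => //.
apply: (rintegrable_le_ae (measurable_sqmod mg) sf).
by apply: filterS gf => z; rewrite ger0_norm// sqmod_ge0.
Qed.

Lemma L2_ae f g : L2 f -> cmeasurable g -> aeeq f g -> L2 g.
Proof.
by move=> Lf mg fg; apply: (L2_le_ae Lf mg); apply: filterS fg => z /= ->.
Qed.

Lemma L2D f g : L2 f -> L2 g -> L2 (fun z => f z + g z).
Proof.
move=> /L2P[mf sf] /L2P[mg sg]; apply/L2P; split; first exact: cmeasurableD.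
apply: (rintegrable_le (measurable_sqmod (cmeasurableD mf mg))).
  exact: (rintegrableZ 2 (rintegrableD sf sg)).
move=> z; rewrite ger0_norm ?sqmod_ge0// /sqmod !ReImE.
move: (Re (f z)) (Im (f z)) (Re (g z)) (Im (g z)) => a b c d.
by have := sqr_ge0 (a - c); have := sqr_ge0 (b - d); nra.
Qed.

Lemma L2Z (c : R[i]) f : L2 f -> L2 (fun z => c * f z).
Proof.
move=> /L2P[mf sf]; apply/L2P; split.
  by apply: cmeasurableM => //; exact: cmeasurable_cst.
by under [X in EFin \o X]eq_fun do rewrite sqmodM; exact: rintegrableZ.
Qed.

Lemma L2N f : L2 f -> L2 (fun z => - f z).
Proof. by move=> /(L2Z (-1)); under eq_fun do rewrite mulN1r. Qed.

Lemma L2B f g : L2 f -> L2 g -> L2 (fun z => f z - g z).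
Proof. by move=> Lf Lg; apply: L2D => //; exact: L2N. Qed.

Lemma L2J f : L2 f -> L2 (fun z => conjc (f z)).
Proof.
move=> Lf; apply: (L2_le_ae Lf); first exact/cmeasurableJ/L2_cmeasurable.
by apply: aeW => z; rewrite sqmodJ.
Qed.

(** The multipliers g used below are inner functions, powers of z and the
    symbol, all bounded by one. *)
Lemma L2M f g : L2 f -> cmeasurable g -> {ae m, forall z, sqmod (g z) <= 1} ->
  L2 (fun z => g z * f z).
Proof.
move=> Lf mg g1; apply: (L2_le_ae Lf).
  by apply: cmeasurableM => //; exact: L2_cmeasurable.
by apply: filterS g1 => z g1; rewrite sqmodM ler_piMl// sqmod_ge0.
Qed.

Lemma L2_cintegrableM f g : L2 f -> L2 g -> cintegrable (fun z => f z * g z).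
Proof.
move=> /L2P[mf sf] /L2P[mg sg].
have [mr mi] := cmeasurableM mf mg.
by split; [apply: (rintegrable_le mr (rintegrableD sf sg))
          |apply: (rintegrable_le mi (rintegrableD sf sg))];
  move=> z; rewrite /sqmod !ReImE;
  move: (Re (f z)) (Im (f z)) (Re (g z)) (Im (g z)) => a b c d;
  rewrite ler_norml; apply/andP; split;
  have := sqr_ge0 (a - c); have := sqr_ge0 (b - d);
  have := sqr_ge0 (a + c); have := sqr_ge0 (b + d);
  have := sqr_ge0 (a - d); have := sqr_ge0 (b - c);
  have := sqr_ge0 (a + d); have := sqr_ge0 (b + c); nra.
Qed.

Lemma L2_inner_integrable f g : L2 f -> L2 g -> cintegrable (fun z => f z * conjc (g z)).
Proof. by move=> Lf Lg; apply: L2_cintegrableM => //; exact: L2J. Qed.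

Lemma L2_cintegrable f : L2 f -> cintegrable f.
Proof.
by move=> /L2_cintegrableM /(_ (L2_cst 1)); under eq_fun do rewrite mulr1.
Qed.

Lemma L2_circleX (n : int) : L2 (fun z : T => sval z ^ n).
Proof.
apply: (L2_le_ae (L2_cst 1)); first exact: cmeasurable_circleX.
by apply: aeW => z; rewrite sqmod_circleX /sqmod/= expr1n expr0n addr0.
Qed.

Lemma ae_sqmod_circleX (n : int) : {ae m, forall z : T, sqmod (sval z ^ n) <= 1}.
Proof. by apply: aeW => z; rewrite sqmod_circleX. Qed.

Lemma L2_mulX (n : int) f : L2 f -> L2 (fun z => sval z ^ n * f z).
Proof.
by move=> Lf; apply: (L2M Lf); [exact: cmeasurable_circleX|exact: ae_sqmod_circleX].
Qed.

Lemma sqnorm_ge0 f : 0 <= sqnorm f.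
Proof. by apply: Rintegral_ge0 => z _; exact: sqmod_ge0. Qed.

Lemma sqnorm_ae f g : L2 f -> L2 g -> aeeq f g -> sqnorm f = sqnorm g.
Proof.
move=> [mf _] [mg _] fg; apply: rintegral_ae; [exact: measurable_sqmod..|].
by apply: filterS fg => z /= ->.
Qed.

Lemma sqnorm_eq0 f : L2 f -> sqnorm f = 0 -> aeeq f (cst 0).
Proof.
move=> Lf f0; have := rintegral_eq0_ae (L2_integrable Lf) _ f0.
move=> /(_ (aeW _ (fun z => sqmod_ge0 _))); apply: filterS => z.
by move=> /eqP; rewrite sqmod_eq0 => /eqP.
Qed.

Lemma sqnormD f g : L2 f -> L2 g -> sqnorm (fun z => f z + g z) =
  sqnorm f + 2 * Re (inner_prod f g) + sqnorm g.
Proof.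
move=> Lf Lg; rewrite /sqnorm /inner_prod /=.
have [i1 i2] := L2_inner_integrable Lf Lg.
have sf := L2_integrable Lf; have sg := L2_integrable Lg.
rewrite -RintegralZl// -RintegralD//; last exact: rintegrableZ.
rewrite -RintegralD//; last by apply: rintegrableD => //; exact: rintegrableZ.
by apply: eq_Rintegral => z _; rewrite /sqmod !ReImE; ring.
Qed.

Lemma sqnormZ (c : R[i]) f : L2 f -> sqnorm (fun z => c * f z) = sqmod c * sqnorm f.
Proof.
move=> Lf; rewrite /sqnorm -RintegralZl//; last exact: L2_integrable.
by apply: eq_Rintegral => z _; rewrite sqmodM.
Qed.

Lemma inner_prodZr (c : R[i]) f g : L2 f -> L2 g ->
  inner_prod f (fun z => c * g z) = conjc c * inner_prod f g.
Proof.
move=> Lf Lg; rewrite /inner_prod -cintegralZ; last exact: L2_inner_integrable.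
by congr cintegral; apply/funext => z; rewrite rmorphM mulrCA.
Qed.

End complex_integral.

(** * Completeness of L^2 and orthogonal projections *)

Section hilbert_projection.
Context {R : realType}.
Local Notation T := (circle R).
Local Notation m := (@arclength R).
Local Notation Re := (@complex.Re R).
Local Notation Im := (@complex.Im R).
Implicit Types (f g h : T -> R[i]) (V W : set (T -> R[i])).

(** Summability of the L^1 distances makes the telescoping series absolutely
    convergent almost everywhere. *)
Lemma rapid_L1_ae_cvg (h : nat -> T -> R) (K : R) :
  (forall n, measurable_fun setT (h n)) ->
  (forall n, (\int[m]_z `|h n.+1 z - h n z|%:E <= (K / (2 ^ n.+1)%:R)%:E)%E) ->
  exists p : T -> R, measurable_fun setT p /\
    {ae m, forall z, h n z @[n --> \oo] --> p z}.
Proof.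
move=> mh hK.
pose d n z := `|h n.+1 z - h n z|%:E.
have md n : measurable_fun setT (d n).
  by apply/measurable_EFinP; apply: measurableT_comp => //; exact: measurable_funB.
pose S z := (\sum_(0 <= n <oo) d n z)%E.
have mS : measurable_fun setT S.
  by apply: ge0_emeasurable_sum => // n z _ _; rewrite lee_fin.
have S0 z : (0 <= S z)%E by apply: nneseries_ge0 => n _ _; rewrite lee_fin.
have K0 : 0 <= K.
  have I0 : (0 <= \int[m]_z `|h 1%N z - h 0%N z|%:E)%E.
    by apply: integral_ge0 => z _; rewrite lee_fin.
  by have := le_trans I0 (hK 0%N); rewrite lee_fin pmulr_lge0// invr_gt0.
have iS : m.-integrable setT S.
  apply/integrableP; split=> //.
  under eq_integral do rewrite gee0_abs//.
  rewrite integral_nneseries//; last by move=> n z _; rewrite lee_fin.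
  apply: (@le_lt_trans _ _ K%:E); last exact: ltry.
  apply: le_trans (epsilon_trick0 xpredT K0).
  apply: lee_nneseries => [n _ _|n _]; last exact: hK.
  by apply: integral_ge0 => z _; rewrite lee_fin.
exists (fun z => fine (limn_esup (fun n => (h n z)%:E))); split.
  apply: (measurableT_comp (fine_measurable measurableT)).
  apply: measurable_fun_limn_esup => n; exact/measurable_EFinP.
have := integrable_ae measurableT iS; apply: filterS => z /(_ I) Sz.
have hcv : cvgn (fun n => h n z).
  rewrite (_ : (fun n => h n z) = (fun n => h 0%N z + series (telescope (h^~ z)) n)).
    apply: is_cvgD; first exact: is_cvg_cst.
    apply: (@normed_cvg R R).
    rewrite (_ : [normed series (telescope (h^~ z))] =
        (fun n => \sum_(0 <= k < n) `|h k.+1 z - h k z|))//.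
    apply: nondecreasing_is_cvgn.
      by apply/nondecreasing_seqP => n; rewrite big_nat_recr//= lerDl.
    exists (fine (S z)) => _ [n _ <-]; rewrite -lee_fin fineK//.
    rewrite -sumEFin; apply: nneseries_lim_ge => k _ _.
    by rewrite lee_fin.
  by apply/funext => n; exact: eq_sum_telescope.
rewrite (_ : fine _ = limn (fun n => h n z)); first exact: hcv.
have hcvE : (h n z)%:E @[n --> \oo] --> (limn (fun n => h n z))%:E.
  by apply: cvg_EFin => //; exact: nearW.
by rewrite (cvg_limn_einf_sup hcvE).2.
Qed.

(** Fatou's lemma serves twice in the construction of projections: it puts an
    almost everywhere limit in L^2 and it bounds distances to that limit. *)
Lemma sqnorm_fatou (r : nat -> T -> R[i]) f (B : R) :
  (forall n, L2 (r n)) -> cmeasurable f -> (forall n, sqnorm (r n) <= B) ->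
  {ae m, forall z, sqmod (r n z) @[n --> \oo] --> sqmod (f z)} ->
  L2 f /\ sqnorm f <= B.
Proof.
move=> Lr mf rB rf.
have intr n : (\int[m]_z (sqmod (r n z))%:E <= B%:E)%E.
  have /L2_integrable ir := Lr n.
  by rewrite -[leLHS]fineK ?lee_fin; [exact: rB|exact: (integrable_fin_num _ ir)].
have mr n : measurable_fun setT (fun z => (sqmod (r n z))%:E).
  by apply/measurable_EFinP; apply: measurable_sqmod; exact: L2_cmeasurable.
have intf : (\int[m]_z (sqmod (f z))%:E <= B%:E)%E.
  have -> : (\int[m]_z (sqmod (f z))%:E)%E =
            (\int[m]_z limn_einf (fun n => (sqmod (r n z))%:E))%E.
    apply: ge0_ae_eq_integral => //.
    - by apply/measurable_EFinP; exact: measurable_sqmod.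
    - rewrite (_ : (fun z => _) =
          (fun z => - limn_esup (fun n => - (sqmod (r n z))%:E))%E).
        apply: measurableT_comp => //.
        by apply: measurable_fun_limn_esup => n; exact: measurableT_comp.
      by apply/funext => z; rewrite -[LHS]oppeK -limn_esupN.
    - by move=> z _; rewrite lee_fin sqmod_ge0.
    - move=> z _; rewrite limn_einf_lim; apply: lime_ge; first exact: is_cvg_einfs.
      apply: nearW => n; apply: le_ereal_inf_tmp => _ [k _ <-].
      by rewrite lee_fin sqmod_ge0.
    - apply: filterS rf => z rf _.
      by apply/esym; apply: (cvg_limn_einf_sup _).1; apply: cvg_EFin => //; exact: nearW.
  apply: le_trans (fatou m measurableT mr _) _ => [n z _|].
    by rewrite lee_fin sqmod_ge0.
  rewrite limn_einf_lim; apply: lime_le; first exact: is_cvg_einfs.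
  apply: nearW => n; apply: le_trans (intr n); apply: ereal_inf_lbound.
  by exists n => /=.
have Lf : L2 f.
  apply/L2P; split=> //; apply/integrableP; split.
    by apply/measurable_EFinP; exact: measurable_sqmod.
  under eq_integral do rewrite /= ger0_norm ?sqmod_ge0//.
  by apply: le_lt_trans intf _; exact: ltry.
split=> //; rewrite -lee_fin fineK//.
exact: (integrable_fin_num _ (L2_integrable Lf)).
Qed.

(** Integrate 2|a| <= c a^2 + 1/c over a space of mass one; a large weight c
    turns a small L^2 norm into a small L^1 norm. *)
Lemma L1_le_sqnorm f (a : T -> R) (c : R) : 0 < c -> L2 f ->
  measurable_fun setT a -> (forall z, a z ^+ 2 <= sqmod (f z)) ->
  (\int[m]_z `|a z|%:E <= ((c * sqnorm f + c^-1) / 2)%:E)%E.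
Proof.
move=> c0 Lf ma af; have sf := L2_integrable Lf.
have ib : m.-integrable setT (EFin \o (fun z => 2^-1 * (c * sqmod (f z) + c^-1))).
  by apply: rintegrableZ; apply: rintegrableD; [exact: rintegrableZ|exact: rintegrable_cst].
have -> : ((c * sqnorm f + c^-1) / 2)%:E =
    (\int[m]_z (2^-1 * (c * sqmod (f z) + c^-1))%:E)%E.
  rewrite -[RHS]fineK; last exact: (integrable_fin_num _ ib).
  congr EFin; rewrite -/(Rintegral _ _ _) RintegralZl//; last first.
    by apply: rintegrableD; [exact: rintegrableZ|exact: rintegrable_cst].
  rewrite RintegralD//; [|exact: rintegrableZ|exact: rintegrable_cst].
  by rewrite RintegralZl// rintegral_cst mulrC.
apply: ge0_le_integral => //.
- by apply/measurable_EFinP; exact: measurableT_comp.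
- by case/integrableP: ib.
- move=> z _; rewrite lee_fin; apply: (@le_trans _ _ (2^-1 * (c * a z ^+ 2 + c^-1))).
    rewrite -[a z ^+ 2]real_normK ?num_real//; move: (`|a z|) => b.
    have := sqr_ge0 (c * b - 1); have cV : c * c^-1 = 1 by rewrite mulfV// gt_eqF.
    have c0' : 0 < c^-1 by rewrite invr_gt0.
    move: c^-1 cV c0' => d cd d0 h.
    have : 0 <= d * (c * b - 1) ^+ 2 by rewrite mulr_ge0 ?sqr_ge0// ltW.
    have -> : d * (c * b - 1) ^+ 2 = (c * d) * (c * b ^+ 2) - 2 * (c * d) * b + d by ring.
    by rewrite cd; lra.
  by rewrite ler_wpM2l// lerD2r ler_wpM2l// ltW.
Qed.

(** Completeness of L^2. The geometric Cauchy rate makes the whole sequence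
    converge almost everywhere. *)
Lemma L2_complete (g : nat -> T -> R[i]) : (forall n, L2 (g n)) ->
  (forall n k, (n <= k)%N ->
     sqnorm (fun z => g n z - g k z) <= 4 * (2^-1 ^+ n) ^+ 2) ->
  exists p, cmeasurable p /\
    {ae m, forall z, Re (g n z) @[n --> \oo] --> Re (p z) /\
                     Im (g n z) @[n --> \oo] --> Im (p z)}.
Proof.
move=> Lg gg.
have H n (a : T -> R) : measurable_fun setT a ->
    (forall z, a z ^+ 2 <= sqmod (g n z - g n.+1 z)) ->
    (\int[m]_z `|a z|%:E <= (5 / (2 ^ n.+1)%:R)%:E)%E.
  move=> ma ag.
  (* with weight 2^n the assumed rate contributes 4 and the term 1/c another 1 *)
  have c0 : 0 < 2 ^+ n :> R by rewrite exprn_gt0.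
  apply: le_trans (L1_le_sqnorm c0 (L2B (Lg n) (Lg n.+1)) ma ag) _.
  rewrite lee_fin natrX exprS invfM; have := gg n n.+1 (leqnSn n).
  have := mulfV (lt0r_neq0 c0); rewrite exprVn; have : 0 < (2 ^+ n)^-1 :> R by rewrite invr_gt0.
  move: (2 ^+ n) (2 ^+ n)^-1 c0 (sqnorm _) => c d c0 s d0 cd sd.
  have : c * s <= c * (4 * d ^+ 2) by rewrite ler_wpM2l// ltW.
  have -> : c * (4 * d ^+ 2) = 4 * (c * d) * d by ring.
  by rewrite cd; lra.
have mg n := L2_cmeasurable (Lg n).
have [p1 [mp1 cp1]] : exists p : T -> R, measurable_fun setT p /\
    {ae m, forall z, Re (g n z) @[n --> \oo] --> p z}.
  apply: (@rapid_L1_ae_cvg (fun n z => Re (g n z)) 5) => [n|n]; first exact: (mg n).1.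
  apply: H; first exact: (measurable_funB (mg n.+1).1 (mg n).1).
  by move=> z; rewrite /sqmod !ReImE; have := sqr_ge0 (Im (g n z) - Im (g n.+1 z)); nra.
have [p2 [mp2 cp2]] : exists p : T -> R, measurable_fun setT p /\
    {ae m, forall z, Im (g n z) @[n --> \oo] --> p z}.
  apply: (@rapid_L1_ae_cvg (fun n z => Im (g n z)) 5) => [n|n]; first exact: (mg n).2.
  apply: H; first exact: (measurable_funB (mg n.+1).2 (mg n).2).
  by move=> z; rewrite /sqmod !ReImE; have := sqr_ge0 (Re (g n z) - Re (g n.+1 z)); nra.
exists (fun z => p1 z +i* p2 z); split; first by split.
by apply: filterS2 cp1 cp2.
Qed.

(** Elements of L^2 are represented by functions, so closedness is stated for
    sequences and norm convergence. With a constant sequence the last condition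
    makes V stable under almost everywhere equality. *)
Definition closed_subspace V : Prop :=
  [/\ V `<=` @L2 R,
      V (cst 0),
      forall (c : R[i]) f g, V f -> V g -> V (fun z => f z + c * g z)
    & forall (g : nat -> T -> R[i]) p, (forall n, V (g n)) -> L2 p ->
        sqnorm (fun z => g n z - p z) @[n --> \oo] --> 0 -> V p].

Lemma sqnorm_parallelogram f g : L2 f -> L2 g ->
  sqnorm (fun z => f z - g z) + sqnorm (fun z => f z + g z) =
  2 * sqnorm f + 2 * sqnorm g.
Proof.
move=> Lf Lg; rewrite /sqnorm.
have sf := L2_integrable Lf; have sg := L2_integrable Lg.
have sB := L2_integrable (L2B Lf Lg); have sD := L2_integrable (L2D Lf Lg).
have sf2 := rintegrableZ 2 sf; have sg2 := rintegrableZ 2 sg.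
rewrite -!RintegralZl// -!RintegralD//.
by apply: eq_Rintegral => z _; rewrite /sqmod !ReImE; ring.
Qed.

(** The nearest point of V to f: a minimizing sequence is Cauchy by the
    parallelogram law, and minimality along every line p + c g forces f - p to
    be orthogonal to g. *)
Theorem orth_proj_exists V f : closed_subspace V -> L2 f ->
  exists p, orth_proj_of V f p.
Proof.
move=> [VL V0 VD Vc] Lf.
pose E := [set sqnorm (fun z => f z - g z) | g in V].
have hE : has_inf E.
  split; first by exists (sqnorm (fun z => f z - cst 0 z)), (cst 0).
  by exists 0 => _ [g _ <-]; exact: sqnorm_ge0.
have dE g : V g -> inf E <= sqnorm (fun z => f z - g z).
  by move=> Vg; apply: ge_inf; [exact: hE.2|exists g].
have q0 n : 0 < (2^-1 ^+ n) ^+ 2 :> R by rewrite !exprn_gt0// invr_gt0.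
have /choice[g gP] : forall n, exists g, V g /\
    sqnorm (fun z => f z - g z) < inf E + (2^-1 ^+ n) ^+ 2.
  by move=> n; have [_ [g Vg <-] gE] := inf_adherent (q0 n) hE; exists g.
have Vg n := (gP n).1.
have Lg n := VL _ (Vg n).
have Lfg n := L2B Lf (Lg n).
have qn n k : (n <= k)%N -> (2^-1 ^+ k) ^+ 2 <= (2^-1 ^+ n) ^+ 2 :> R.
  move=> nk; rewrite ler_sqr ?nnegrE ?exprn_ge0 ?invr_ge0//.
  by apply: ler_wiXn2l => //; rewrite ?invr_ge0// invf_le1// ler1n.
have gg n k : (n <= k)%N -> sqnorm (fun z => g n z - g k z) <= 4 * (2^-1 ^+ n) ^+ 2.
  move=> nk.
  (* the midpoint of two points of V is no closer to f than the infimum *)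
  have Vmid : V (fun z => 2^-1 * (g n z + g k z)).
    have := VD 2^-1 _ _ V0 (VD 1 _ _ (Vg n) (Vg k)).
    by congr V; apply/funext => z /=; rewrite add0r mul1r.
  have := sqnorm_parallelogram (Lfg k) (Lfg n).
  rewrite (_ : (fun z => f z - g k z - (f z - g n z)) = (fun z => g n z - g k z)); last first.
    by apply/funext => z; ring.
  rewrite (_ : (fun z => f z - g k z + (f z - g n z)) =
    (fun z => 2 * (f z - 2^-1 * (g n z + g k z)))); last first.
    by apply/funext => z; field.
  rewrite sqnormZ; last exact: L2B (VL _ Vmid).
  have -> : sqmod (2 : R[i]) = 4 by rewrite /sqmod /=; ring.
  have := dE _ Vmid; have := (gP n).2; have := (gP k).2; have := qn _ _ nk.
  by lra.
have [p [mp cp]] := L2_complete Lg gg.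
have cvp (h : T -> R[i]) : {ae m, forall z,
    sqmod (h z - g n z) @[n --> \oo] --> sqmod (h z - p z)}.
  apply: filterS cp => z [c1 c2]; rewrite /sqmod !ReImE.
  under eq_cvg do rewrite !ReImE.
  by apply: cvgD; rewrite !expr2; apply: cvgM; apply: cvgB => //; exact: cvg_cst.
have shift n (h : T -> R[i]) : {ae m, forall z,
    sqmod (h z - g (n + k)%N z) @[k --> \oo] --> sqmod (h z - p z)}.
  apply: filterS (cvp h) => z.
  by rewrite -(cvg_shiftn n)/=; under [X in X -> _]eq_cvg do rewrite addnC.
have gp n : L2 (fun z => g n z - p z) /\
    sqnorm (fun z => g n z - p z) <= 4 * (2^-1 ^+ n) ^+ 2.
  apply: (sqnorm_fatou _ _ _ (shift n (g n))) => [k||k].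
  - exact: L2B.
  - by apply: cmeasurableB => //; exact: L2_cmeasurable.
  - exact/gg/leq_addr.
have Lp : L2 p.
  have := L2B (Lg 0%N) (gp 0%N).1.
  by congr L2; apply/funext => z; ring.
have Vp : V p.
  apply: (Vc g) => //.
  apply: (@squeeze_cvgr _ _ _ _ (fun=> 0) (fun n => 4 * (2^-1 ^+ n) ^+ 2)).
  - by apply: nearW => n; rewrite sqnorm_ge0 (gp n).2.
  - exact: cvg_cst.
  - rewrite -[X in _ --> X](mulr0 4) -(mulr0 0); apply: cvgM; first exact: cvg_cst.
    by under eq_cvg do rewrite expr2; apply: cvgM; apply: cvg_expr;
      rewrite ger0_norm ?invr_ge0// invf_lt1// ltr1n.
have fp : sqnorm (fun z => f z - p z) <= inf E.
  apply/ler_addgt0Pr => e e0.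
  have [n ne] : exists n, (2^-1 ^+ n) ^+ 2 < e :> R.
    have : (2^-1 ^+ n) ^+ 2 @[n --> \oo] --> (0 : R).
      rewrite -(mulr0 0); under eq_cvg do rewrite expr2.
      by apply: cvgM; apply: cvg_expr;
        rewrite ger0_norm ?invr_ge0// invf_lt1// ltr1n.
    move=> /cvgrPdist_lt /(_ e e0)[n _ /(_ n (leqnn n))].
    by rewrite sub0r normrN gtr0_norm// => ?; exists n.
  have [] : L2 (fun z => f z - p z) /\
      sqnorm (fun z => f z - p z) <= inf E + (2^-1 ^+ n) ^+ 2.
    apply: (sqnorm_fatou _ _ _ (shift n f)) => [k||k].
    - exact: L2B.
    - exact/L2_cmeasurable/L2B.
    - by apply: le_trans (ltW (gP _).2) _; rewrite lerD2l qn// leq_addr.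
  by move=> _ h; apply: le_trans h _; rewrite lerD2l ltW.
exists p; split=> // h Vh.
have Lh := VL _ Vh; have Lfp := L2B Lf Lp.
set w := inner_prod _ h.
(* minimality of p along the line through p directed by w h, at parameter t *)
have key t : 0 <= (t ^+ 2 * sqnorm h - 2 * t) * sqmod w.
  have := le_trans fp (dE _ (VD (t%:C * w) _ _ Vp Vh)).
  rewrite (_ : (fun z => f z - (p z + t%:C * w * h z)) =
    (fun z => (f z - p z) + (- (t%:C * w)) * h z)); last by apply/funext => z; ring.
  rewrite (sqnormD Lfp (L2Z (- (t%:C * w)) Lh)).
  rewrite inner_prodZr// sqnormZ// -/w.
  rewrite /sqmod !ReImE /=; move: (Re w) (Im w) (sqnorm h) (sqnorm _) => a b s r.
  by rewrite !mul0r !subr0 !addr0; move=> hh; rewrite -subr_ge0 in hh; move: hh; congr (0 <= _); ring.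
have G0 : 0 < 1 + sqnorm h by rewrite ltr_pwDl// sqnorm_ge0.
apply/eqP; rewrite -sqmod_eq0 eq_le sqmod_ge0 andbT leNgt; apply/negP => w0.
have := key (1 + sqnorm h)^-1; rewrite pmulr_lge0//.
have := sqnorm_ge0 h; have := mulfV (lt0r_neq0 G0).
have : 0 < (1 + sqnorm h)^-1 by rewrite invr_gt0.
by move: (1 + sqnorm h)^-1 (sqnorm h) => t s t0 ts s0; nra.
Qed.

End hilbert_projection.

(** * Uniqueness of Fourier coefficients *)

Section fourier_uniqueness.
Context {R : realType}.
Local Notation T := (circle R).
Local Notation m := (@arclength R).
Local Notation Re := (@complex.Re R).
Local Notation Im := (@complex.Im R).
Local Notation mu := (@lebesgue_measure R).
Local Notation period := (`[0 : R, 2 * pi]%classic).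
Implicit Types (f g h : T -> R[i]).

(** Arc length is the law of expi under the uniform distribution on a period, so
    integrals over the circle are integrals in the angle. *)
Lemma ge0_integral_circle (f : T -> \bar R) : measurable_fun setT f ->
  (forall z, (0 <= f z)%E) ->
  (\int[m]_z f z =
   ((2 * pi)^-1)%:E * \int[mu]_(t in period) f (expi t))%E.
Proof.
move=> mf f0; rewrite /arclength ge0_integral_distribution//.
rewrite integral_uniform ?subr0//.
by move=> t; exact: f0.
Qed.

Lemma integrable_circle (g : T -> R) : m.-integrable setT (EFin \o g) ->
  mu.-integrable period (EFin \o (g \o @expi R)).
Proof.
case/integrableP => mg ig.
have mge : measurable_fun setT (EFin \o (g \o @expi R)).
  exact: measurableT_comp mg (@measurable_expi R).
apply/integrableP; split; first exact: measurable_funTS.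
move: ig; rewrite ge0_integral_circle//; last first.
  by apply: measurableT_comp.
apply: contraTT; rewrite -!leNgt !leye_eq => /eqP ->.
by rewrite gt0_muley// lte_fin invr_gt0 twopi_gt0.
Qed.

Lemma rintegral_circle (g : T -> R) : m.-integrable setT (EFin \o g) ->
  \int[m]_z g z = (2 * pi)^-1 * \int[mu]_(t in period) g (expi t).
Proof.
move=> ig; have ie := integrable_circle ig.
have mg : measurable_fun setT (EFin \o g) by case/integrableP: ig.
have iep : mu.-integrable period (EFin \o (g \o @expi R))^\+%E.
  exact: integrable_funepos.
rewrite -[_^-1]/(fine (_^-1)%:E) -fineM//; last exact: integrable_fin_num.
congr fine; rewrite integralE [in RHS]integralE !ge0_integral_circle//.
- rewrite -muleBr//; last first.
    apply: fin_num_adde_defr; apply: integrable_fin_num => //.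
    by apply: eq_integrable iep => // t _; rewrite !funeposE.
  by congr (_ * (_ - _))%E; apply: eq_integral => t _; rewrite ?funeposE ?funenegE.
- exact: measurable_funeneg.
- exact: measurable_funepos.
Qed.

Lemma expiX (t : R) (n : nat) :
  sval (expi t) ^+ n = cos (n%:R * t) +i* sin (n%:R * t).
Proof.
elim: n => [|n ih]; first by rewrite expr0 !mul0r cos0 sin0.
rewrite exprSr ih -[n.+1]addn1 natrD mulrDl mul1r cosD sinD /=.
by apply: complex_eqP; rewrite ReImE /=; ring.
Qed.

(** The primitives sin (k t) / k and - cos (k t) / k have period 2 pi. *)
Lemma cintegral_circleX (n : int) : n != 0 -> cintegral (fun z : T => sval z ^ n) = 0.
Proof.
have pos k : (0 < k)%N -> cintegral (fun z : T => sval z ^+ k) = 0.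
  move=> k0; have kR : (k%:R : R) != 0 by rewrite pnatr_eq0 -lt0n.
  have [i1 i2] := L2_cintegrable (@L2_circleX R k).
  have c1 (F f : R -> R) : continuous f -> (forall t : R, is_derive t (1 : R) F (f t)) ->
      F 0 = F (2 * pi) -> \int[mu]_(t in period) f t = 0.
    move=> cf dF F0; rewrite /Rintegral (@continuous_FTC2 _ f F) ?twopi_gt0//.
    - by rewrite F0 /= subrr.
    - exact: continuous_subspaceT.
    - have cF : continuous F.
        by move=> t; apply/differentiable_continuous/derivable1_diffP; case: (dF t).
      split=> [t _||]; first by case: (dF t).
        exact/cvg_at_right_filter/cF.
      exact/cvg_at_left_filter/cF.
    - by move=> t _; rewrite derive1E; apply: derive_val; exact: dF.
  have [c2pi s2pi] : cos (k%:R * (2 * pi)) = 1 :> R /\ sin (k%:R * (2 * pi)) = 0 :> R.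
    have e1 : sval (expi (2 * pi : R)) = 1.
      by apply: complex_eqP => /=; rewrite mulr_natl ?cos2pi ?sin2pi.
    by have := expiX (2 * pi) k; rewrite e1 expr1n => -[<- <-].
  have dk (t : R) : is_derive t (1 : R) (fun t => k%:R * t : R) k%:R.
    by apply: is_derive_eq; rewrite /GRing.scale /= mulr1 ?mulr0 ?add0r.
  have ic : \int[mu]_(t in period) cos (k%:R * t) = 0.
    apply: (c1 (fun t => k%:R^-1 * sin (k%:R * t)) (fun t => cos (k%:R * t))).
    - move=> t; apply: continuous_comp; last exact: continuous_cos.
      by apply: continuousM => //; exact: cst_continuous.
    - move=> t; have ds := is_derive1_comp (is_derive_sin (k%:R * t)) (dk t).
      apply: (is_derive_eq (is_deriveZ k%:R^-1 ds)).
      by rewrite /GRing.scale /=; field.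
    - by rewrite mulr0 sin0 s2pi.
  have is0 : \int[mu]_(t in period) sin (k%:R * t) = 0.
    apply: (c1 (fun t => - k%:R^-1 * cos (k%:R * t)) (fun t => sin (k%:R * t))).
    - move=> t; apply: continuous_comp; last exact: continuous_sin.
      by apply: continuousM => //; exact: cst_continuous.
    - move=> t; have ds := is_derive1_comp (is_derive_cos (k%:R * t)) (dk t).
      apply: (is_derive_eq (is_deriveZ (- k%:R^-1) ds)).
      by rewrite /GRing.scale /=; field.
    - by rewrite mulr0 cos0 c2pi.
  apply: complex_eqP; rewrite /= rintegral_circle//.
    rewrite [X in _ * X](_ : _ = 0) ?mulr0// -[RHS]ic.
    by apply: eq_Rintegral => t _; rewrite expiX.
  rewrite [X in _ * X](_ : _ = 0) ?mulr0// -[RHS]is0.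
  by apply: eq_Rintegral => t _; rewrite expiX.
case: n => n n0; first by apply: pos; rewrite lt0n.
rewrite NegzE (_ : (fun z => _) = (fun z => conjc (sval z ^ (n.+1 : int)))).
  by rewrite cintegralJ ?pos ?conjc0//; exact: L2_cintegrable (@L2_circleX R n.+1).
by apply/funext => z; rewrite conj_circleX.
Qed.

Lemma bernoulli_ge (y : R) (k : nat) : 0 <= y <= 1 -> 1 - k%:R * y <= (1 - y) ^+ k.
Proof.
move=> /andP[y0 y1]; elim: k => [|k ih]; first by rewrite expr0 mul0r subr0.
rewrite exprS -[k.+1]addn1 natrD; have k0 : 0 <= k%:R :> R by [].
have : (1 - y) * (1 - k%:R * y) <= (1 - y) * (1 - y) ^+ k.
  by rewrite ler_wpM2l// subr_ge0.
have : 0 <= k%:R * y * y by rewrite !mulr_ge0.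
by move: (k%:R) ((1 - y) ^+ k) k0 => K E K0; nra.
Qed.

Lemma bernoulli_le (y : R) (k : nat) : 0 <= y <= 1 ->
  (1 - y) ^+ k * (1 + k%:R * y) <= 1.
Proof.
move=> /andP[y0 y1]; elim: k => [|k ih]; first by rewrite expr0 mul0r addr0 mul1r.
have k0 : 0 <= k%:R :> R by [].
have e0 : 0 <= (1 - y) ^+ k by rewrite exprn_ge0// subr_ge0.
apply: le_trans ih; rewrite exprS -mulrA mulrCA ler_wpM2l//.
rewrite -[k.+1]addn1 natrD; have : 0 <= k%:R * y * y by rewrite !mulr_ge0.
by move: (k%:R) k0 => K K0; nra.
Qed.

(** Polynomials in s that approximate the indicator of s < 1/2 on [0, 1], as in
    the classical proof of the Weierstrass theorem. The factor n in the exponent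
    makes them tend to 0 at s = 1/2 as well. *)
Definition step_poly (A : nzRingType) (n : nat) (s : A) : A :=
  (1 - s ^+ n) ^+ (n * 2 ^ n).

Lemma step_poly_bounds (n : nat) (s : R) : 0 <= s <= 1 -> 0 <= step_poly n s <= 1.
Proof.
move=> /andP[s0 s1]; have sn1 : s ^+ n <= 1 by rewrite exprn_ile1.
have sn0 : 0 <= s ^+ n by rewrite exprn_ge0.
by rewrite exprn_ge0 ?subr_ge0// exprn_ile1 ?subr_ge0// lerBlDr lerDl.
Qed.

Lemma step_poly_cvg1 (s : R) : 0 <= s < 2^-1 -> step_poly n s @[n --> \oo] --> (1 : R).
Proof.
move=> /andP[s0 s1].
(* by Bernoulli the defect is at most n (2 s)^n = (n r^n) r^n, where n r^n is
   bounded and r^n tends to 0 *)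
pose r := Num.sqrt (2 * s).
have r0 : 0 <= r by exact: sqrtr_ge0.
have rr : 2 * s = r * r by rewrite -expr2 sqr_sqrtr// mulr_ge0.
have r1 : r < 1 by rewrite -(@ltr_sqr R)// ?nnegrE// expr2 -rr; lra.
pose C := (1 - r)^-1.
have nr n : n%:R * r ^+ n <= C.
  rewrite -[C]mul1r ler_pdivlMr ?subr_gt0//.
  have rn0 : 0 <= r ^+ n by exact: exprn_ge0.
  have : 0 <= 1 - r <= 1 by lra.
  by move=> /(bernoulli_le n); rewrite subKr; move: (n%:R) (r ^+ n) rn0 => N E E0; nra.
apply: (@squeeze_cvgr _ _ _ _ (fun n => 1 - C * r ^+ n) (fun=> 1)).
- apply: nearW => n; have /andP[_ ->] := @step_poly_bounds n s (ltac:(lra)).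
  rewrite andbT; apply: le_trans (bernoulli_ge _ _); last first.
    by rewrite exprn_ge0// exprn_ile1//; lra.
  rewrite lerD2l lerN2 natrM natrX -mulrA -exprMn rr exprMn mulrA.
  by rewrite ler_wpM2r// exprn_ge0.
- rewrite -[X in _ --> X]subr0 -[X in _ - X](mulr0 C).
  apply: cvgB; first exact: cvg_cst.
  by apply: cvgM; [exact: cvg_cst|apply: cvg_expr; rewrite ger0_norm].
- exact: cvg_cst.
Qed.

Lemma step_poly_cvg0 (s : R) : 2^-1 <= s <= 1 -> step_poly n s @[n --> \oo] --> (0 : R).
Proof.
move=> /andP[s0 s1].
apply: (@squeeze_cvgr _ _ _ _ (fun=> 0) (@harmonic R)); last first.
- exact: cvg_harmonic.
- exact: cvg_cst.
apply: nearW => n; have s01 : 0 <= s <= 1 by lra.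
have /andP[-> _] := @step_poly_bounds n s s01.
have sn01 : 0 <= s ^+ n <= 1 by rewrite exprn_ge0 ?exprn_ile1//; lra.
have := bernoulli_le (n * 2 ^ n) sn01.
rewrite -/(step_poly n s) -ler_pdivlMr ?ltr_wpDr// ?mulr_ge0//; last by case/andP: sn01.
move=> /le_trans -> //; rewrite div1r /harmonic /= lef_pV2 ?posrE//; last first.
  by rewrite ltr_wpDr// mulr_ge0//; case/andP: sn01.
rewrite -[n.+1%:R]natr1 addrC lerD2l natrM natrX -mulrA -exprMn ler_peMr//.
by rewrite exprn_ege1//; lra.
Qed.

(** Induction on p: multiplication by s combines the frequencies n, n + 1 and
    n - 1. The induction therefore runs over all n at once. *)
Lemma trig_poly_annihilated f (c0 c1 c2 : R[i]) (p : {poly R[i]}) :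
  cintegrable f -> (forall n, fourier f n = 0) ->
  let s (z : T) := c0 + c1 * sval z + c2 * (sval z)^-1 in
  forall n : int, cintegrable (fun z => f z * p.[s z] * sval z ^ n) /\
    cintegral (fun z => f z * p.[s z] * sval z ^ n) = 0.
Proof.
move=> cf f0 s; elim/poly_ind: p => [|p c ih] n.
  under eq_fun do rewrite horner0 mulr0 mul0r.
  by rewrite cintegral_cst; split=> //; exact: cintegrable_cst.
have [i0 e0] := ih n; have [i1 e1] := ih (n + 1); have [i2 e2] := ih (n - 1).
have [i3 e3] : cintegrable (fun z => f z * sval z ^ n) /\
    cintegral (fun z => f z * sval z ^ n) = 0.
  split; last first.
    by rewrite -[RHS](f0 (- n)); congr cintegral; apply/funext => z;
      rewrite conj_circleX opprK.
  by apply: cintegrableM => // [|z]; [exact: cmeasurable_circleX|rewrite sqmod_circleX].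
have -> : (fun z => f z * (p * 'X + c%:P).[s z] * sval z ^ n) =
    (fun z => (c0 * (f z * p.[s z] * sval z ^ n)
             + c1 * (f z * p.[s z] * sval z ^ (n + 1)))
            + (c2 * (f z * p.[s z] * sval z ^ (n - 1))
             + c * (f z * sval z ^ n))).
  apply/funext => z; rewrite hornerMXaddC !circleXD expr1z exprN1 /s; ring.
have j0 := cintegrableZ c0 i0; have j1 := cintegrableZ c1 i1.
have j2 := cintegrableZ c2 i2; have j3 := cintegrableZ c i3.
have j01 := cintegrableD j0 j1; have j23 := cintegrableD j2 j3.
split; first exact: cintegrableD.
rewrite (cintegralD j01 j23) (cintegralD j0 j1) (cintegralD j2 j3) !cintegralZ//.
by rewrite e0 e1 e2 e3 !mulr0 !addr0.
Qed.

(** An affine function of cos (t - x / 2), at z = expi t, that takes values in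
    [0, 1] and is below 1/2 exactly on the open arc from 1 to expi x. *)
Definition arc_height (x : R) (z : T) : R :=
  2^-1 - (Re (sval z * conjc (sval (expi (x / 2)))) - cos (x / 2)) / 4.

(** The difference of cosines is a product of sines, whose signs decide on which
    side of 1/2 the height lies. *)
Lemma arc_height_expi (x t : R) :
  arc_height x (expi t) = 2^-1 - sin (t / 2) * sin ((x - t) / 2) / 2.
Proof.
rewrite /arc_height ReImE /= mulrN opprK -cosB.
pose a := t / 2; pose b := (x - t) / 2.
rewrite (_ : t - x / 2 = a - b); last by rewrite /a /b; field.
rewrite (_ : x / 2 = a + b); last by rewrite /a /b; field.
by rewrite cosB cosD -/a -/b; field.
Qed.

Lemma arc_height_bounds (x : R) (z : T) : 0 <= arc_height x z <= 1.
Proof.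
rewrite /arc_height.
set w := sval z * _; have : sqmod w = 1 by rewrite sqmodM sqmodJ !sqmod_circle mulr1.
rewrite /sqmod; move: (Re w) (Im w) => a b ab.
have := cos_le1 (x / 2); have := cos_geN1 (x / 2); move: (cos _) => c c1 c2.
have a1 : a <= 1 by have := sqr_ge0 b; nra.
have a2 : -1 <= a by have := sqr_ge0 b; nra.
by apply/andP; split; lra.
Qed.

Lemma arc_height_lt (x t : R) : 0 < x < 2 * pi -> 0 <= t <= 2 * pi ->
  (arc_height x (expi t) < 2^-1) = (0 < t < x).
Proof.
move=> /andP[x0 x2] /andP[]; rewrite arc_height_expi.
rewrite le_eqVlt => /predU1P[<- _|t0].
  by rewrite mul0r sin0 !mul0r subr0 !ltxx.
rewrite le_eqVlt => /predU1P[->|t2].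
  rewrite (_ : 2 * pi / 2 = pi); last by field.
  rewrite sinpi !mul0r subr0 ltxx; apply/esym/negbTE.
  by rewrite negb_and -!leNgt (ltW x2) orbT.
have st : 0 < sin (t / 2) by apply: sin_gt0_pi; apply/andP; split; lra.
rewrite t0 /= gtrBl pmulr_lgt0 ?invr_gt0// pmulr_rgt0//.
have [tx|xt] := ltP t x; first by apply: sin_gt0_pi; apply/andP; split; lra.
apply/negbTE; rewrite -leNgt -oppr_ge0 -sinN.
by apply: sin_ge0_pi; apply/andP; split; lra.
Qed.

Lemma measurable_arc_height (x : R) : measurable_fun setT (arc_height x).
Proof.
apply: measurable_funB => //; apply: measurable_funM => //.
apply: measurable_funB => //.
have := cmeasurableM (@cmeasurable_id R) (cmeasurable_cst (conjc (sval (expi (x / 2))))).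
by case.
Qed.

(** Dominated convergence along step_poly evaluated at arc_height, which are
    trigonometric polynomials. *)
Lemma fourier0_arc f (x : R) : cintegrable f -> (forall n, fourier f n = 0) ->
  m.-integrable setT (EFin \o (fun z => Re (f z) * (arc_height x z < 2^-1)%R%:R)) /\
  \int[m]_z (Re (f z) * (arc_height x z < 2^-1)%R%:R) = 0.
Proof.
move=> cf f0; have [f1 f2] := cf.
pose w := sval (expi (x / 2)).
pose c0 : R[i] := (2^-1 + cos (x / 2) / 4)%:C.
pose c1 : R[i] := (- 8^-1)%:C * conjc w.
pose c2 : R[i] := (- 8^-1)%:C * w.
have sE z : c0 + c1 * sval z + c2 * (sval z)^-1 = (arc_height x z)%:C.
  rewrite -conj_circle /arc_height -/w; by apply: complex_eqP; rewrite !ReImE /=; field.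
pose q n : {poly R[i]} := step_poly n 'X.
have qE n z : (q n).[c0 + c1 * sval z + c2 * (sval z)^-1] =
    (step_poly n (arc_height x z))%:C.
  by rewrite sE /q /step_poly hornerE !hornerE -!rmorphXn /= -rmorphB -rmorphXn.
pose F n z := Re (f z) * step_poly n (arc_height x z).
have mF n : measurable_fun setT (F n).
  apply: measurable_funM; first exact: (cintegrable_measurable cf).1.
  by apply: measurable_funX; apply: measurable_funB => //;
    apply: measurable_funX; exact: measurable_arc_height.
have F0 n : \int[m]_z F n z = 0.
  have [_ /(congr1 Re)] := trig_poly_annihilated c0 c1 c2 (q n) cf f0 0.
  rewrite /= => <-; apply: eq_Rintegral => z _.
  by rewrite expr0z mulr1 qE ReImE /= mulr0 subr0.
pose G z := Re (f z) * (arc_height x z < 2^-1)%R%:R.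
have FG z : F n z @[n --> \oo] --> G z.
  apply: cvgM; first exact: cvg_cst.
  have /andP[h0 h1] := arc_height_bounds x z.
  case: ltP => h; first by apply: step_poly_cvg1; rewrite h0.
  by apply: step_poly_cvg0; rewrite h.
have mG : measurable_fun setT G.
  apply: measurable_funM; first exact: (cintegrable_measurable cf).1.
  apply: (measurableT_comp (f := fun b : bool => b%:R : R)) => //.
  by apply: measurable_fun_ltr => //; exact: measurable_arc_height.
have := @dominated_convergence _ _ _ m setT measurableT (fun n => EFin \o F n)
  (EFin \o G) (EFin \o (fun z => `|Re (f z)|)).
case.
- by move=> n; apply/measurable_EFinP.
- exact/measurable_EFinP.
- by apply: aeW => z _; apply: cvg_EFin; [exact: nearW|exact: FG].
- exact: integrable_norm.
- apply: aeW => z n _; rewrite /= lee_fin normrM ler_piMr//.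
  have /andP[? ?] := step_poly_bounds n (arc_height_bounds x z).
  by rewrite ger0_norm.
- move=> iG _ cG; split=> //.
  suff -> : \int[m]_z G z = fine 0%E by [].
  congr fine; apply/esym; apply: cvg_unique (cG) => //.
  rewrite (_ : (fun n => _) = cst 0%E); first exact: cvg_cst.
  apply/funext => n; rewrite -[LHS]fineK.
    by congr EFin; exact: F0.
  apply: integrable_fin_num => //; apply: (rintegrable_le (mF n) (integrable_norm f1)) => z.
  rewrite normrM ler_piMr//.
  have /andP[? ?] := step_poly_bounds n (arc_height_bounds x z).
  by rewrite ger0_norm.
Qed.

(** By the vanishing of integrals over arcs, the primitive of Re f in the angle is
    zero, and Lebesgue differentiation recovers Re f from it. *)
Lemma fourier0_Re f : cintegrable f -> (forall n, fourier f n = 0) ->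
  {ae m, forall z, Re (f z) = 0}.
Proof.
move=> cf f0; have [f1 f2] := cf.
have ie := integrable_circle f1.
pose h (t : R) : R := Re (f (expi t)).
have cpi : 0 < (2 * pi)^-1 :> R by rewrite invr_gt0 twopi_gt0.
have whole : \int[mu]_(t in period) h t = 0.
  have : \int[m]_z Re (f z) = 0.
    rewrite -[RHS]/(Re 0) -(f0 0); apply: eq_Rintegral => z _.
    by rewrite expr0z conjc1 mulr1.
  by rewrite rintegral_circle// => /eqP; rewrite mulf_eq0 gt_eqF//= => /eqP.
have part x : 0 < x < 2 * pi -> \int[mu]_(t in period) (h t * (0 < t < x)%R%:R) = 0.
  move=> xb; have [iG] := fourier0_arc x cf f0.
  rewrite rintegral_circle// => /eqP; rewrite mulf_eq0 gt_eqF//= => /eqP e.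
  rewrite -[RHS]e; apply: eq_Rintegral => t; rewrite inE /= in_itv/= => tb.
  by rewrite arc_height_lt.
(* on the half-open period the primitive vanishes identically up to 0 *)
pose H := h \_ `]0, 2 * pi].
have ie' : mu.-integrable `]0, 2 * pi] (EFin \o h).
  by apply: integrableS ie => // t /=; rewrite !in_itv/= => /andP[/ltW -> ->].
have iH : mu.-integrable setT (EFin \o H).
  by rewrite -restrict_EFin; apply: (proj1 (integrable_mkcond _ _)) ie'.
have prim y : \int[mu]_(t in [set` `]-oo, y]%R]) H t = 0.
  have [y2|y2] := leP (2 * pi) y.
    rewrite Rintegral_mkcond -[RHS]whole -Rintegral_itv_obnd_cbnd//.
    rewrite [RHS]Rintegral_mkcond; apply: eq_Rintegral => t _.
    rewrite /H !patchE; case: ifPn => // /negP ty; case: ifPn => // /set_mem /=.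
    rewrite in_itv/= => /andP[_ t2]; case: ty.
    by rewrite inE /= in_itv/= (le_trans t2).
  rewrite -Rintegral_itv_bndo_bndc//; last by apply: integrableS iH.
  rewrite Rintegral_mkcond.
  have [y0|y0] := leP y 0.
    rewrite (_ : _ \_ _ = cst 0) ?Rintegral_cst ?mul0r//.
    apply/funext => t; rewrite /H !patchE; case: ifPn => // /set_mem /=; rewrite in_itv/= => ty.
    case: ifPn => // /set_mem /=; rewrite in_itv/= => /andP[t0 _].
    by have := lt_trans t0 (lt_le_trans ty y0); rewrite ltxx.
  rewrite -[RHS](part y) ?y0//.
  rewrite [RHS]Rintegral_mkcond; apply: eq_Rintegral => t _.
  rewrite /H !patchE.
  have memE (i : interval R) : (t \in [set` i]) = (t \in i).
    by apply/idP/idP => [/set_mem//|]; exact: mem_set.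
  rewrite !memE !in_itv/=; have [ty|ty] := ltP t y; last first. by rewrite andbF mulr0; case: ifP.
  rewrite (ltW (lt_trans ty y2)) !andbT.
  by have [t0|t0] := ltP 0 t; rewrite ?(ltW t0) ?mulr1// mulr0; case: ifP.

have lH : locally_integrable [set: R] H by exact: integrable_locally.
have iHy y : mu.-integrable [set` `]-oo, y]%R] (EFin \o H) by exact: integrableS iH.
have H0 : {ae mu, forall t, H t = 0}.
  have := FTC1Ny iHy lH.
  apply: filterS; first exact: (ae_filter_ringOfSetsType mu).
  move=> t [_ <-].
  rewrite (_ : (fun x => _) = cst 0); last by apply/funext => y; exact: prim.
  by rewrite derive1_cst.
have ia := integrable_norm f1.
have := @rintegral_eq0_ae R _ ia (aeW _ (fun z => normr_ge0 _)).
rewrite rintegral_circle//.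
suff -> : \int[mu]_(t in period) `|h t| = 0.
  rewrite mulr0 => /(_ erefl); apply: filterS => z /= /eqP.
  by rewrite normr_eq0 => /eqP.
rewrite -Rintegral_itv_obnd_cbnd//; last exact: integrable_norm ie'.
have iaH : mu.-integrable setT (EFin \o ((fun t => `|h t|) \_ `]0, 2 * pi])).
  rewrite -restrict_EFin.
  exact: (proj1 (integrable_mkcond _ _) (integrable_norm ie')).
rewrite Rintegral_mkcond -[RHS]/(fine 0%E) -(integral0 mu setT).
congr fine; apply: ae_eq_integral => //; first by case/integrableP: iaH.
apply: filterS H0; first exact: (ae_filter_ringOfSetsType mu).
move=> t Ht _ /=; move: Ht; rewrite /H !patchE; case: ifPn => // _ ->.
by rewrite normr0.
Qed.

Theorem fourier0_ae f : cintegrable f -> (forall n, fourier f n = 0) ->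
  aeeq f (cst 0).
Proof.
move=> cf f0.
(* the real part of - i f is the imaginary part of f *)
have ci : cintegrable (fun z => -'i * f z) by exact: cintegrableZ.
have i0 n : fourier (fun z => -'i * f z) n = 0.
  rewrite /fourier; under eq_fun do rewrite -mulrA.
  rewrite cintegralZ; first by rewrite [X in _ * X]f0 mulr0.
  apply: cintegrableM => // [|z]; first exact/cmeasurableJ/cmeasurable_circleX.
  by rewrite sqmodJ sqmod_circleX.
apply: filterS2 (fourier0_Re cf f0) (fourier0_Re ci i0) => z hr hi.
by apply: complex_eqP => //=; move: hi; rewrite !ReImE /=; lra.
Qed.

End fourier_uniqueness.

(** * Closed subspaces of L^2 *)

Section closed_subspaces.
Context {R : realType}.
Local Notation T := (circle R).
Local Notation m := (@arclength R).
Local Notation Re := (@complex.Re R).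
Implicit Types (f g h : T -> R[i]) (V W : set (T -> R[i])).

Lemma inner_prodE f g : inner_prod f g = cintegral (fun z => f z * conjc (g z)).
Proof. by []. Qed.

Lemma inner_prodD f g h : L2 f -> L2 g -> L2 h ->
  inner_prod (fun z => f z + g z) h = inner_prod f h + inner_prod g h.
Proof.
move=> Lf Lg Lh; rewrite /inner_prod -cintegralD; [|exact: L2_inner_integrable..].
by congr cintegral; apply/funext => z; rewrite mulrDl.
Qed.

Lemma inner_prodZl (c : R[i]) f h : L2 f -> L2 h ->
  inner_prod (fun z => c * f z) h = c * inner_prod f h.
Proof.
move=> Lf Lh; rewrite /inner_prod -cintegralZ; last exact: L2_inner_integrable.
by congr cintegral; apply/funext => z; rewrite mulrA.
Qed.

Lemma inner_prodB f g h : L2 f -> L2 g -> L2 h ->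
  inner_prod (fun z => f z - g z) h = inner_prod f h - inner_prod g h.
Proof.
move=> Lf Lg Lh; rewrite (inner_prodD Lf (L2N Lg) Lh).
rewrite (_ : (fun z => - g z) = (fun z => -1 * g z)).
  by rewrite inner_prodZl// mulN1r.
by apply/funext => z; rewrite mulN1r.
Qed.

Lemma inner_prodDr f g h : L2 f -> L2 g -> L2 h ->
  inner_prod f (fun z => g z + h z) = inner_prod f g + inner_prod f h.
Proof.
move=> Lf Lg Lh; rewrite /inner_prod -cintegralD; [|exact: L2_inner_integrable..].
by congr cintegral; apply/funext => z; rewrite rmorphD mulrDr.
Qed.

Lemma inner_prod_sqnorm f : inner_prod f f = (sqnorm f)%:C.
Proof.
rewrite /inner_prod; under eq_fun do rewrite mul_conjc.
by apply: complex_eqP => //=; rewrite rintegral_cst.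
Qed.

Lemma inner_prod_ael f g h : cmeasurable f -> cmeasurable g -> cmeasurable h ->
  aeeq f g -> inner_prod f h = inner_prod g h.
Proof.
move=> mf mg mh fg; apply: cintegral_ae.
- by apply: cmeasurableM => //; exact: cmeasurableJ.
- by apply: cmeasurableM => //; exact: cmeasurableJ.
- by apply: filterS fg => z ->.
Qed.

Lemma inner_prod_aer f g h : cmeasurable f -> cmeasurable g -> cmeasurable h ->
  aeeq g h -> inner_prod f g = inner_prod f h.
Proof.
move=> mf mg mh fg; apply: cintegral_ae.
- by apply: cmeasurableM => //; exact: cmeasurableJ.
- by apply: cmeasurableM => //; exact: cmeasurableJ.
- by apply: filterS fg => z ->.
Qed.

Lemma L2_cst0 : L2 (cst 0 : T -> R[i]).
Proof. exact: L2_cst. Qed.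

(** A weak form of the Cauchy-Schwarz inequality, enough for continuity: it is
    2|a b| <= |a|^2 / t + t |b|^2 integrated. *)
Lemma inner_prod_bound f g (t : R) : 0 < t -> L2 f -> L2 g ->
  2 * `|Re (inner_prod f g)| <= t^-1 * sqnorm f + t * sqnorm g.
Proof.
move=> t0 Lf Lg.
have key (s : R) : s ^+ 2 = 1 ->
    0 <= t^-1 * sqnorm f + 2 * (s * Re (inner_prod f g)) + t * sqnorm g.
  move=> s1; have := sqnorm_ge0 (fun z => f z + (t * s)%:C * g z).
  rewrite (sqnormD Lf (L2Z (t * s)%:C Lg)) inner_prodZr// sqnormZ//.
  have tV : t^-1 * t = 1 by rewrite mulVf// gt_eqF.
  have tV0 : 0 <= t^-1 by rewrite invr_ge0 ltW.
  move: (inner_prod f g) (sqnorm f) (sqnorm g) => [a b] c d /(mulr_ge0 tV0).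
  rewrite /sqmod /=; congr (0 <= _).
  have -> : t^-1 * (c + 2 * (t * s * a - - 0 * b) + ((t * s) ^+ 2 + 0 ^+ 2) * d) =
    t^-1 * c + (t^-1 * t) * (2 * (s * a)) + (t^-1 * t) * (t * s ^+ 2 * d) by ring.
  by rewrite tV s1; ring.
have := key 1; have := key (-1); rewrite sqrrN expr1n => /(_ erefl) k1 /(_ erefl) k2.
case: (ger0P (Re (inner_prod f g))) => _; lra.
Qed.

Lemma closed_L2 : closed_subspace (@L2 R).
Proof.
split=> //; first exact: L2_cst0.
by move=> c f g Lf Lg; apply: L2D => //; exact: L2Z.
Qed.

Lemma inner_prod_closed (g : nat -> T -> R[i]) f h : (forall n, L2 (g n)) ->
  L2 f -> L2 h -> sqnorm (fun z => g n z - f z) @[n --> \oo] --> 0 ->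
  (forall n, inner_prod (g n) h = 0) -> inner_prod f h = 0.
Proof.
move=> Lg Lf Lh gf gh.
have ReP (k : T -> R[i]) : L2 k -> (forall n, inner_prod (g n) k = 0) ->
    Re (inner_prod f k) = 0.
  move=> Lk gk; apply/eqP; rewrite -normr_le0; apply/ler_addgt0Pr => e e0.
  rewrite add0r.
  have K0 : 0 < 1 + sqnorm k by rewrite ltr_pwDl// sqnorm_ge0.
  (* this weight makes both terms of the bound at most e *)
  pose t := e / (1 + sqnorm k).
  have t0 : 0 < t by rewrite divr_gt0.
  have te0 : 0 < t * e by rewrite mulr_gt0.
  have /cvgrPdist_lt /(_ _ te0) [n _ /(_ n (leqnn n))] := gf.
  rewrite sub0r normrN ger0_norm ?sqnorm_ge0// => ne.
  have := inner_prod_bound t0 (L2B (Lg n) Lf) Lk.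
  rewrite inner_prodB// gk sub0r Re_opp normrN.
  have : t^-1 * sqnorm (fun z => g n z - f z) <= e.
    by rewrite ler_pdivrMl//; exact: ltW.
  have : t * sqnorm k <= e.
    by rewrite /t mulrAC ler_pdivrMr// ler_wpM2l// ?ltW// ltrDr.
  by lra.
apply: complex_eqP; first exact: ReP.
have := ReP (fun z => 'i * h z) (L2Z 'i Lh).
rewrite inner_prodZr// !ReImE /= => hi.
have : forall n, inner_prod (g n) (fun z => 'i * h z) = 0.
  by move=> n; rewrite inner_prodZr// gh mulr0.
by move=> /hi; lra.
Qed.

Lemma closed_ominus V W : closed_subspace V -> W `<=` @L2 R ->
  closed_subspace (ominus V W).
Proof.
move=> [VL V0 VD Vc] WL; split.
- by move=> f [/VL].
- split=> // g _; rewrite /inner_prod; under eq_fun do rewrite mul0r.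
  exact: cintegral_cst.
- move=> c f g [Vf fW] [Vg gW]; split; first exact: VD.
  move=> h Wh; rewrite (inner_prodD (VL _ Vf) (L2Z c (VL _ Vg)) (WL _ Wh)).
  by rewrite (inner_prodZl c (VL _ Vg) (WL _ Wh)) fW// gW// mulr0 addr0.
- move=> g p gV Lp gp; split; first by apply: (Vc g) => // n; case: (gV n).
  move=> h Wh; apply: (inner_prod_closed _ Lp (WL _ Wh) gp) => n.
    by apply: VL; case: (gV n).
  by case: (gV n) => _; exact.
Qed.

Lemma closed_setI V W : closed_subspace V -> closed_subspace W ->
  closed_subspace (V `&` W).
Proof.
move=> [VL V0 VD Vc] [WL W0 WD Wc]; split=> //.
- by move=> f [/VL].
- by move=> c f g [? ?] [? ?]; split; [exact: VD|exact: WD].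
- move=> g p gVW Lp gp; split; [apply: (Vc g)|apply: (Wc g)] => // n;
    by case: (gVW n).
Qed.

Lemma closed_subspace_ae V f g : closed_subspace V -> V f -> cmeasurable g ->
  aeeq f g -> V g.
Proof.
move=> [VL _ _ Vc] Vf mg fg; have Lf := VL _ Vf; have Lg := L2_ae Lf mg fg.
apply: (Vc (fun=> f)) => //.
rewrite (_ : (fun _ => _) = cst 0); first exact: cvg_cst.
apply/funext => n; rewrite (@sqnorm_ae _ _ (cst 0)).
- rewrite /sqnorm /sqmod /= expr0n /= addr0; exact: rintegral_cst.
- exact: L2B.
- exact: L2_cst0.
- by apply: filterS fg => z ->; rewrite subrr.
Qed.

Lemma closed_ae0 : closed_subspace [set f : T -> R[i] | L2 f /\ aeeq f (cst 0)].
Proof.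
split.
- by move=> f [].
- by split; [exact: L2_cst0|exact: aeW].
- move=> c f g [Lf f0] [Lg g0]; split; first by apply: L2D => //; exact: L2Z.
  by apply: filterS2 f0 g0 => z -> ->; rewrite /= mulr0 addr0.
- move=> g p gV Lp gp; split=> //; apply: sqnorm_eq0 => //.
  suff E : (fun n => sqnorm (fun z => g n z - p z)) = cst (sqnorm p).
    by move: gp; rewrite E => /cvg_lim <- //; rewrite lim_cst.
  apply/funext => n; have [Lg g0] := gV n; rewrite (@sqnorm_ae _ _ (fun z => - p z)).
  + by rewrite /sqnorm; apply: eq_Rintegral => z _; rewrite /sqmod !ReImE; ring.
  + exact: L2B.
  + exact: L2N.
  + by apply: filterS g0 => z ->; rewrite sub0r.
Qed.

(** Multiplication by e is a bounded operator on L^2, so that it pulls closed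
    subspaces back to closed subspaces. *)
Lemma closed_mul_preimage V (e : T -> R[i]) : closed_subspace V ->
  cmeasurable e -> {ae m, forall z, sqmod (e z) <= 1} ->
  closed_subspace [set f | L2 f /\ V (fun z => e z * f z)].
Proof.
move=> [VL V0 VD Vc] me e1; split.
- by move=> f [].
- split; first exact: L2_cst0.
  by have -> : (fun z => e z * cst 0 z) = cst 0 by apply/funext => z; rewrite /= mulr0.
- move=> c f g [Lf Vf] [Lg Vg]; split; first by apply: L2D => //; exact: L2Z.
  by have := VD c _ _ Vf Vg; congr V; apply/funext => z; ring.
- move=> g p gV Lp gp; split=> //.
  have Lg n : L2 (g n) by case: (gV n).
  apply: (Vc (fun n z => e z * g n z)) => [n||]; [by case: (gV n)|exact: L2M|].
  apply: (squeeze_cvgr _ (cvg_cst 0) gp); apply: nearW => n; rewrite sqnorm_ge0 /=.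
  have LB := L2B (Lg n) Lp.
  have -> : sqnorm (fun z => e z * g n z - e z * p z) =
            sqnorm (fun z => e z * (g n z - p z)).
    by congr sqnorm; apply/funext => z; rewrite mulrBr.
  apply: ae_le_rintegral; [exact/L2_integrable/L2M|exact: L2_integrable|].
  by apply: filterS e1 => z e1; rewrite sqmodM ler_piMl// sqmod_ge0.
Qed.

End closed_subspaces.

(** * Products in the Hardy space *)

Section hardy.
Context {R : realType}.
Local Notation T := (circle R).
Local Notation m := (@arclength R).
Implicit Types (f g h u v w y : T -> R[i]) (V W M : set (T -> R[i])).

Lemma fourierE f n : fourier f n = cintegral (fun z => f z * sval z ^ (- n)).
Proof. by congr cintegral; apply/funext => z; rewrite conj_circleX. Qed.

Lemma H2E : @H2 R = ominus (@L2 R) [set (fun z : T => sval z ^ n) | n in [set n : int | n < 0]].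
Proof.
apply/seteqP; split=> f [Lf f0]; split=> //.
  by move=> _ [n n0 <-]; exact: f0.
by move=> n n0; apply: f0; exists n.
Qed.

Lemma closed_H2 : closed_subspace (@H2 R).
Proof.
rewrite H2E; apply: closed_ominus; first exact: closed_L2.
by move=> _ [n _ <-]; exact: L2_circleX.
Qed.

Lemma closed_H2minus : closed_subspace (@H2minus R).
Proof. by apply: closed_ominus; [exact: closed_L2|move=> f []]. Qed.

Lemma H2_circleX (k : nat) : H2 (fun z : T => sval z ^ k).
Proof.
split; first exact: L2_circleX.
move=> n n0; rewrite fourierE; under eq_fun do rewrite -circleXD.
by apply: cintegral_circleX; lia.
Qed.

(** The conclusion is clear when f is a polynomial. For fixed g and n it holds on
    a closed subspace of H^2, and what is orthogonal to that subspace in H^2 has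
    no Fourier coefficient at all. *)
Lemma H2_product f g (n : int) : H2 f -> H2 g -> 0 < n ->
  cintegral (fun z => f z * g z * sval z ^ n) = 0.
Proof.
move=> Hf [Lg g0] n0.
pose gn z := conjc (sval z ^ n * g z).
have Lgn : L2 gn by exact/L2J/L2_mulX.
pose V := ominus (@H2 R) [set gn].
have VE h : V h <-> H2 h /\ inner_prod h gn = 0.
  by split=> -[Hh h0]; split=> //; [exact: h0|move=> _ ->].
have cV : closed_subspace V.
  by apply: closed_ominus; [exact: closed_H2|move=> _ ->].
have VX (k : nat) : V (fun z => sval z ^ k).
  apply/VE; split; first exact: H2_circleX.
  rewrite -[RHS](g0 (- (n + k))); last by lia.
  rewrite fourierE inner_prodE; congr cintegral; apply/funext => z.
  by rewrite /gn conjcK opprK circleXD mulrCA mulrA mulrC; ring.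
have [p [Vp pP]] := orth_proj_exists cV Hf.1.
have [Hp _] := (VE p).1 Vp.
have Lr := L2B Hf.1 Hp.1.
have r0 : aeeq (fun z => f z - p z) (cst 0).
  apply: fourier0_ae; first exact: L2_cintegrable.
  case=> k; first exact: (pP _ (VX k)).
  rewrite /fourier -/(inner_prod _ (fun z => sval z ^ _)) inner_prodB//; last first.
  - exact: L2_circleX.
  - exact: Hp.1.
  - exact: Hf.1.
  by rewrite [X in X - _](Hf.2 (Negz k))// [X in _ - X](Hp.2 (Negz k))// subr0.
have : V f.
  apply: (closed_subspace_ae cV Vp); first exact: L2_cmeasurable Hf.1.
  by apply: filterS r0 => z /eqP; rewrite subr_eq0 => /eqP.
move=> /VE[_]; rewrite inner_prodE => <-; congr cintegral; apply/funext => z.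
by rewrite /gn conjcK; ring.
Qed.

Lemma H2M u f : H2 u -> {ae m, forall z, sqmod (u z) <= 1} -> H2 f ->
  H2 (fun z => u z * f z).
Proof.
move=> Hu u1 Hf; split; first exact: (L2M Hf.1 (L2_cmeasurable Hu.1) u1).
by move=> n n0; rewrite fourierE; apply: H2_product => //; lia.
Qed.

Lemma H2_mulX f : H2 f -> H2 (fun z => sval z * f z).
Proof.
move=> Hf; have := H2M (H2_circleX 1) (ae_sqmod_circleX 1) Hf.
by [].
Qed.

(** The reflection f |-> conj (z f) sends the Fourier index n to - 1 - n, hence
    exchanges H^2 and its orthogonal complement. *)
Lemma H2_of_H2minus y : H2minus y -> H2 (fun z => conjc (sval z * y z)).
Proof.
move=> [Ly y0]; split; first exact/L2J/(L2_mulX 1 Ly).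
case=> // k _; rewrite fourierE.
have := y0 _ (H2_circleX k); rewrite inner_prodE => e.
rewrite -[RHS]conjc0 -e -cintegralJ; last exact: L2_inner_integrable Ly (L2_circleX k).
congr cintegral; apply/funext => z; rewrite !rmorphM /= conjcK NegzE opprK.
by rewrite -addn1 PoszD circleXD expr1z conj_circle mulrC -mulrA mulrA; field; rewrite circle_neq0.
Qed.

Lemma H2minus_of_H2 w : H2 w -> H2minus (fun z => conjc (sval z * w z)).
Proof.
move=> Hw; split; first exact/L2J/(L2_mulX 1 Hw.1).
move=> g Hg; rewrite inner_prodE -[RHS]conjc0 -(@H2_product w g 1)//.
rewrite -cintegralJ.
  by congr cintegral; apply/funext => z; rewrite expr1z -!rmorphM; congr conjc; ring.
have := L2_cintegrableM (L2_mulX 1 Hw.1) Hg.1; congr cintegrable.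
by apply/funext => z; ring.
Qed.

Lemma Loo_sqmod_le f : cLnorm +oo%E f = 1%E -> {ae m, forall z, sqmod (f z) <= 1}.
Proof.
rewrite /cLnorm unlock /=; rewrite ifT; last by rewrite [X in (_ < X)%E]arclength_setT.
move=> fN; have := ess_sup_ge m (abse \o (EFin \o (fun z => Normc.normc (f z)))).
rewrite fN; apply: filterS => z /=; rewrite lee_fin ger0_norm ?normc_ge0// => f1.
by rewrite -normc_sqr expr_le1// normc_ge0.
Qed.

Lemma is_innerP u : is_inner u <-> H2 u /\ {ae m, forall z, sqmod (u z) = 1}.
Proof.
split=> [[[Hu _] u1]|[Hu u1]].
  by split=> //; apply: filterS u1 => z /normc_eq1.
have u1' : {ae m, forall z, Normc.normc (u z) = 1}.
  by apply: filterS u1 => z /normc_eq1.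
split=> //; split=> //; split; first exact: L2_cmeasurable Hu.1.
rewrite /cLnorm unlock /=; case: ifP => // _.
apply: (@le_lt_trans _ _ 1%E); last exact: ltry.
apply/ess_supP; apply: filterS u1' => z /= ->.
by rewrite lee_fin normr1.
Qed.

Lemma ae_le1 f : {ae m, forall z, sqmod (f z) = 1} -> {ae m, forall z, sqmod (f z) <= 1}.
Proof. by apply: filterS => z ->. Qed.

Lemma is_innerM u v : is_inner u -> is_inner v -> is_inner (fun z => u z * v z).
Proof.
move=> /is_innerP[Hu u1] /is_innerP[Hv v1]; apply/is_innerP; split.
  exact: H2M (ae_le1 u1) Hv.
by apply: filterS2 u1 v1 => z; rewrite sqmodM => -> ->; rewrite mulr1.
Qed.

End hardy.

(** * Inner functions in shift-invariant subspaces *)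

Section invariant_subspaces.
Context {R : realType}.
Local Notation T := (circle R).
Local Notation m := (@arclength R).
Implicit Types (f g h u v w y phi : T -> R[i]) (V W M : set (T -> R[i])).

Lemma H2_fourier0 f : H2 f -> (forall k : nat, fourier f k = 0) -> aeeq f (cst 0).
Proof.
move=> Hf f0; apply: fourier0_ae; first exact: L2_cintegrable Hf.1.
by case=> k; [exact: f0|exact: Hf.2].
Qed.

Lemma fourier_backward_shift f (n : int) :
  fourier (fun z => conjc (sval z) * f z) n = fourier f (n + 1).
Proof.
rewrite !fourierE; congr cintegral; apply/funext => z.
by rewrite conj_circle opprD circleXD exprN1; ring.
Qed.

(** The functions of M are divisible by every power of z inside H^2, so none of
    their Fourier coefficients survives. *)
Lemma backward_shift_invariant_eq0 M : M `<=` @H2 R ->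
  (forall f, M f -> M (fun z => conjc (sval z) * f z)) ->
  forall f, M f -> aeeq f (cst 0).
Proof.
move=> MH Mz f Mf; apply: H2_fourier0; first exact: MH.
suff H (k : nat) h : M h -> fourier h k = 0 by move=> k; exact: H.
elim: k h => [|k ih] h Mh.
  have := (MH _ (Mz _ Mh)).2 (-1) isT; rewrite fourier_backward_shift.
  by rewrite addNr.
by have := ih _ (Mz _ Mh); rewrite fourier_backward_shift -PoszD addn1.
Qed.

(** The existence half of Beurling's theorem. A vector r of M orthogonal to z M
    has constant modulus, because the Fourier coefficients of |r|^2 are the inner
    products of r with its own shifts; such an r exists because M is not z M. *)
Theorem shift_invariant_inner M f0 : closed_subspace M -> M `<=` @H2 R ->
  (forall f, M f -> M (fun z => sval z * f z)) ->
  M f0 -> ~ aeeq f0 (cst 0) ->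
  exists2 theta, M theta & is_inner theta.
Proof.
move=> cM MH Mz Mf0 f0N; have [ML M0 MD Mc] := cM.
have cz : cmeasurable (fun z : T => conjc (sval z)) by exact/cmeasurableJ/cmeasurable_id.
have z1 : {ae m, forall z : T, sqmod (conjc (sval z)) <= 1}.
  by apply: aeW => z; rewrite sqmodJ sqmod_circle.
pose zM := [set f | L2 f /\ M (fun z => conjc (sval z) * f z)].
have czM : closed_subspace zM by exact: closed_mul_preimage.
have conjzK h : (fun z : T => conjc (sval z) * (sval z * h z)) = h.
  by apply/funext => z; rewrite conj_circle mulrA mulVf ?mul1r// circle_neq0.
have [f Mf fN] : exists2 f, M f & ~ M (fun z => conjc (sval z) * f z).
  apply: contrapT => hN; apply: f0N.
  apply: (backward_shift_invariant_eq0 MH _ Mf0) => f Mf; apply: contrapT => fN.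
  by apply: hN; exists f.
have [p [[Lp Mp] pP]] := orth_proj_exists czM (ML _ Mf).
have Mp' : M p.
  have := Mz _ Mp; congr M; apply/funext => z.
  by rewrite conj_circle mulrA mulfV ?mul1r// circle_neq0.
pose r z := f z - p z.
have Mr : M r.
  have := MD (-1) _ _ Mf Mp'; congr M.
  by apply/funext => z; rewrite mulN1r.
have Lr := ML _ Mr.
have rX (k : nat) : M (fun z => sval z ^+ k * r z).
  elim: k => [|k ih]; first by under eq_fun do rewrite expr0 mul1r.
  by have := Mz _ ih; congr M; apply/funext => z; rewrite exprS mulrA.
have rperp (k : nat) : cintegral (fun z => (sqmod (r z))%:C * conjc (sval z ^+ k.+1)) = 0.
  have zMr : zM (fun z => sval z ^+ k.+1 * r z).
    split; first exact: ML _ (rX _).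
    have := rX k; congr M; apply/funext => z.
    by rewrite exprS -mulrA conj_circle mulrA mulVf ?mul1r// circle_neq0.
  rewrite -[RHS](pP _ zMr) inner_prodE; congr cintegral; apply/funext => z.
  by rewrite -/(r z) -mul_conjc rmorphM; ring.
pose c := sqnorm r.
have isq : cintegrable (fun z => (sqmod (r z))%:C).
  split; first exact: L2_integrable.
  by exact: rintegrable_cst.
have cst_mod : {ae m, forall z, sqmod (r z) = c}.
  have cf : cintegrable (fun z => (sqmod (r z))%:C - c%:C).
    by apply: cintegrableB => //; exact: cintegrable_cst.
  suff H n : fourier (fun z => (sqmod (r z))%:C - c%:C) n = 0.
    apply: filterS (fourier0_ae cf H) => z /eqP.
    by rewrite subr_eq0 => /eqP -[].
  have e (z : T) : sqmod (sval z ^ (- n)) <= 1 by rewrite sqmod_circleX.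
  have i1 : cintegrable (fun z => (sqmod (r z))%:C * sval z ^ (- n)).
    by apply: cintegrableM => //; exact: cmeasurable_circleX.
  have i2 := cintegrableZ c%:C (L2_cintegrable (@L2_circleX R (- n))).
  rewrite fourierE; under eq_fun do rewrite mulrBl.
  rewrite (cintegralB i1 i2) cintegralZ; last exact: L2_cintegrable (L2_circleX _).
  have [->|n0] := eqVneq n 0.
    rewrite oppr0; under eq_fun do rewrite expr0z mulr1.
    under [X in _ - _ * cintegral X]eq_fun do rewrite expr0z.
    rewrite cintegral_cst mulr1 /cintegral /= rintegral_cst.
    by rewrite -/(sqnorm r) subrr.
  rewrite cintegral_circleX ?oppr_eq0// mulr0 subr0.
  case: n n0 {e i1 i2} => [[|k]|k] // _.
    by rewrite -(rperp k); congr cintegral; apply/funext => z; rewrite -conj_circleX.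
  rewrite -[RHS]conjc0 -(rperp k) -cintegralJ.
    congr cintegral; apply/funext => z.
    by rewrite rmorphM /= conjcK oppr0 NegzE opprK.
  apply: cintegrableM => // [|z]; first exact/cmeasurableJ/(@cmeasurable_circleX R k.+1).
  by rewrite sqmodJ (@sqmod_circleX R z k.+1).
have c0 : 0 < c.
  rewrite lt_neqAle sqnorm_ge0 andbT eq_sym; apply/eqP => c0; apply: fN.
  apply: (closed_subspace_ae cM Mp).
    by apply: cmeasurableM => //; exact: L2_cmeasurable (ML _ Mf).
  apply: filterS cst_mod => z /eqP; rewrite c0 sqmod_eq0 /r subr_eq0 => /eqP ->.
  by [].
pose a : R[i] := ((Num.sqrt c)^-1)%:C.
exists (fun z => a * r z).
  by have := MD a _ _ M0 Mr; congr M; apply/funext => z; rewrite add0r.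
apply/is_innerP; split.
  by apply: MH; have := MD a _ _ M0 Mr; congr M; apply/funext => z; rewrite add0r.
apply: filterS cst_mod => z rc; rewrite sqmodM rc /sqmod /= expr0n /= addr0.
by rewrite exprVn sqr_sqrtr ?mulVf ?gt_eqF// ltW.
Qed.

(** * Model spaces *)

Lemma uH2_L2 u : is_inner u -> uH2 u `<=` @L2 R.
Proof.
move=> /is_innerP[Hu u1] _ [g Hg <-].
exact: L2M Hg.1 (L2_cmeasurable Hu.1) (ae_le1 u1).
Qed.

Lemma closed_model_space u : is_inner u -> closed_subspace (model_space u).
Proof. by move=> iu; apply: closed_ominus; [exact: closed_H2|exact: uH2_L2]. Qed.

(** H^2 is the orthogonal sum of the model space and of u H^2, so a function
    orthogonal to both lies in the complement of H^2. *)
Lemma H2minus_of_orthogonal u f : is_inner u -> L2 f ->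
  (forall g, model_space u g -> inner_prod f g = 0) ->
  (forall g, uH2 u g -> inner_prod f g = 0) -> H2minus f.
Proof.
move=> iu Lf fK fu; split=> // h Hh.
have /is_innerP[Hu u1] := iu; have mu := L2_cmeasurable Hu.1.
have muJ := cmeasurableJ mu.
have uJ1 : {ae m, forall z, sqmod (conjc (u z)) <= 1}.
  by apply: filterS u1 => z; rewrite sqmodJ => ->.
(* u H^2 up to almost everywhere equality, hence closed *)
pose V := [set g | L2 g /\ H2 (fun z => conjc (u z) * g z)].
have cV : closed_subspace V by apply: closed_mul_preimage => //; exact: closed_H2.
have [p [[Lp Hp] pP]] := orth_proj_exists cV Hh.1.
have up : aeeq (fun z => u z * (conjc (u z) * p z)) p.
  by apply: filterS u1 => z u1; rewrite mulrA mul_conjc u1 mul1r.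
have Hp' : H2 p.
  apply: (closed_subspace_ae closed_H2 _ (L2_cmeasurable Lp) up).
  exact: H2M Hu (ae_le1 u1) Hp.
have Kr : model_space u (fun z => h z - p z).
  split.
    have [_ _ HD _] := @closed_H2 R.
    rewrite (_ : (fun z => h z - p z) = (fun z => h z + -1 * p z)); first exact: HD.
    by apply/funext => z; rewrite mulN1r.
  move=> _ [g Hg <-]; apply: pP; split.
    exact: L2M Hg.1 mu (ae_le1 u1).
  apply: (closed_subspace_ae closed_H2 Hg).
    by apply: cmeasurableM => //; apply: cmeasurableM => //; exact: L2_cmeasurable Hg.1.
  by apply: filterS u1 => z u1; rewrite mulrA [conjc _ * _]mulrC mul_conjc u1 mul1r.
have Lup : L2 (fun z => u z * (conjc (u z) * p z)).
  exact: L2M Hp.1 mu (ae_le1 u1).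
have -> : h = (fun z => (h z - p z) + p z) by apply/funext => z; rewrite subrK.
rewrite inner_prodDr//; last exact: (L2B Hh.1 Lp).
rewrite fK// add0r -(inner_prod_aer (L2_cmeasurable Lf) (L2_cmeasurable Lup) (L2_cmeasurable Lp) up).
by apply: fu; exists (fun z => conjc (u z) * p z).
Qed.

(** A projection of f belongs to V and is orthogonal to V, hence to itself; when
    there is none, the default value of orth_proj is zero as well. *)
Lemma orth_proj_orthogonal V f : V `<=` @L2 R -> L2 f ->
  (forall g, V g -> inner_prod f g = 0) -> aeeq (orth_proj V f) (cst 0).
Proof.
move=> VL Lf f0; rewrite /orth_proj; case: xgetP => [p _ [Vp pP]|_]; last exact: aeW.
have Lp := VL _ Vp.
apply: sqnorm_eq0 => //; have := pP _ Vp; rewrite inner_prodB// f0// sub0r.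
by rewrite inner_prod_sqnorm => /eqP; rewrite oppr_eq0 => /eqP -[].
Qed.

Lemma L2_orth_proj V f : V `<=` @L2 R -> L2 (orth_proj V f).
Proof.
move=> VL; rewrite /orth_proj; case: xgetP => [p _ [Vp _]|_]; first exact: VL.
exact: L2_cst0.
Qed.

Lemma cLnorm2_sqnorm f : L2 f -> cLnorm 2%:E f = ((sqnorm f)%:E `^ 2^-1)%E.
Proof.
move=> Lf; rewrite Lnorm2E; congr (_ `^ _)%E; rewrite /sqnorm fineK//.
exact: (integrable_fin_num _ (L2_integrable Lf)).
Qed.

Lemma cLnorm2_inj f g : L2 f -> L2 g -> cLnorm 2%:E f = cLnorm 2%:E g ->
  sqnorm f = sqnorm g.
Proof.
move=> Lf Lg; rewrite !cLnorm2_sqnorm// !poweR_EFin => -[].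
rewrite !powR12_sqrt ?sqnorm_ge0// => e.
by rewrite -(sqr_sqrtr (sqnorm_ge0 f)) e sqr_sqrtr// sqnorm_ge0.
Qed.

End invariant_subspaces.

(** * Extremal vectors and quotients of inner functions *)

Section extremal_vectors.
Context {R : realType}.
Local Notation T := (circle R).
Local Notation m := (@arclength R).
Implicit Types (f g h u v w y phi psi chi theta : T -> R[i]) (V W M : set (T -> R[i])).

(** Extremality of y forces both inequalities in the chain
    |D_phi y| <= |phi y| <= |y| of L^2 norms to be equalities. *)
Lemma extremal_contraction u phi y : is_inner u -> cmeasurable phi ->
  {ae m, forall z, sqmod (phi z) <= 1} -> L2 y -> extremal u phi y ->
  (forall g, model_space u g -> inner_prod (fun z => phi z * y z) g = 0) /\
  {ae m, forall z, sqmod (phi z) * sqmod (y z) = sqmod (y z)}.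
Proof.
move=> iu mphi phi1 Ly [_ Dy].
have Lf : L2 (fun z => phi z * y z) by exact: L2M.
have cK := closed_model_space iu; have [KL _ _ _] := cK.
pose p := orth_proj (model_space u) (fun z => phi z * y z).
have [Kp pP] : orth_proj_of (model_space u) (fun z => phi z * y z) p.
  have [q qP] := orth_proj_exists cK Lf.
  by rewrite /p /orth_proj; case: xgetP => [//|/(_ q)].
have Lp := KL _ Kp; have Ld := L2B Lf Lp.
have sD : sqnorm (fun z => phi z * y z - p z) = sqnorm y := cLnorm2_inj Ld Ly Dy.
have pyth : sqnorm (fun z => phi z * y z) = sqnorm y + sqnorm p.
  rewrite -sD (_ : (fun z => phi z * y z) = (fun z => (phi z * y z - p z) + p z)); last first.
    by apply/funext => z; rewrite subrK.
  rewrite (sqnormD Ld Lp) pP// mulr0 addr0.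
  by congr (_ + _); congr sqnorm; apply/funext => z; rewrite addrK.
have ae_le : {ae m, forall z, sqmod (phi z * y z) <= sqmod (y z)}.
  by apply: filterS phi1 => z h; rewrite sqmodM ler_piMl// sqmod_ge0.
have fy : sqnorm (fun z => phi z * y z) <= sqnorm y.
  by apply: ae_le_rintegral => //; exact: L2_integrable.
have p0 : sqnorm p = 0.
  by apply/eqP; rewrite eq_le sqnorm_ge0 andbT; move: fy; rewrite pyth gerDl.
have ap := sqnorm_eq0 Lp p0.
split=> [g Kg|].
  rewrite -[RHS](pP _ Kg); have Lg := KL _ Kg.
  apply: inner_prod_ael; [exact: L2_cmeasurable Lf|exact: L2_cmeasurable Ld
    |exact: L2_cmeasurable Lg|].
  by apply: filterS ap => z ->; rewrite subr0.
have i1 := L2_integrable Ly; have i2 := L2_integrable Lf.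
have d0 : {ae m, forall z, sqmod (y z) - sqmod (phi z * y z) = 0}.
  apply: rintegral_eq0_ae.
  - by apply: rintegrableD => //; exact: rintegrableN.
  - by apply: filterS ae_le => z; rewrite subr_ge0.
  - rewrite RintegralB// -[X in X - _]/(sqnorm y).
    by rewrite -[X in _ - X]/(sqnorm (fun z => phi z * y z)) pyth p0 addr0 subrr.
by apply: filterS d0 => z /eqP; rewrite subr_eq0 sqmodM => /eqP.
Qed.

(** The equation (1 - |phi|^2) f = 0 says that f vanishes where |phi| is not 1, in
    a form that passes to limits in L^2. *)
Definition quotient_space phi : set (T -> R[i]) :=
  @H2 R `&`
  ([set f | L2 f /\ H2 (fun z => conjc (phi z) * f z)] `&`
   [set f | L2 f /\ (L2 (fun z => (1 - sqmod (phi z))%:C * f z) /\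
                     aeeq (fun z => (1 - sqmod (phi z))%:C * f z) (cst 0))]).

(** The space above is shift-invariant, so it contains an inner function theta.
    As theta vanishes nowhere, |phi| = 1 almost everywhere, and then
    chi = conj(phi) theta is inner with phi = theta conj(chi). *)
Lemma inner_quotient phi w : cmeasurable phi ->
  {ae m, forall z, sqmod (phi z) <= 1} -> H2 w -> ~ aeeq w (cst 0) ->
  H2 (fun z => conjc (phi z) * w z) ->
  {ae m, forall z, sqmod (phi z) * sqmod (w z) = sqmod (w z)} ->
  exists theta chi, [/\ is_inner theta, is_inner chi &
    aeeq phi (fun z => theta z * conjc (chi z))].
Proof.
move=> mphi phi1 Hw w0 Hpw pw.
have mJ := cmeasurableJ mphi.
have J1 : {ae m, forall z, sqmod (conjc (phi z)) <= 1}.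
  by apply: filterS phi1 => z; rewrite sqmodJ.
have me : cmeasurable (fun z => (1 - sqmod (phi z))%:C).
  split; last exact: measurable_cst.
  by apply: measurable_funB => //; exact: measurable_sqmod.
have e1 : {ae m, forall z, sqmod ((1 - sqmod (phi z))%:C) <= 1}.
  apply: filterS phi1 => z h; rewrite /sqmod /= expr0n /= addr0 -/(sqmod (phi z)).
  by rewrite expr_le1// ?subr_ge0// gerBl sqmod_ge0.
have cM : closed_subspace (quotient_space phi).
  apply: closed_setI; first exact: closed_H2.
  apply: closed_setI; first by apply: closed_mul_preimage => //; exact: closed_H2.
  by apply: (closed_mul_preimage closed_ae0).
have [theta [Ht [[_ Hpt] [_ [_ et]]]] it] :
    exists2 theta, quotient_space phi theta & is_inner theta.
  apply: (shift_invariant_inner cM _ _ _ w0).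
  - by move=> f [].
  - move=> f [Hf [[_ Hpf] [Lf [_ ef]]]]; have Hzf := H2_mulX Hf.
    split=> //; split; split; try exact: Hzf.1.
      rewrite (_ : (fun z => _) = (fun z => sval z * (conjc (phi z) * f z))).
        exact: H2_mulX.
      by apply/funext => z; ring.
    split; first exact: L2M Hzf.1 me e1.
    by apply: filterS ef => z /= ef; rewrite mulrCA ef mulr0.
  - split=> //; split; split; rewrite ?/mkset; try exact: Hw.1.
      by [].
    split; first exact: L2M Hw.1 me e1.
    apply: filterS pw => z /eqP; rewrite -subr_eq0 -[X in _ - X]mul1r -mulrBl.
    rewrite mulf_eq0 => /orP[/eqP h|].
      by rewrite -opprB h oppr0 mul0r.
    by rewrite sqmod_eq0 => /eqP ->; rewrite mulr0.
have /is_innerP[_ t1] := it.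
have phi_unimodular : {ae m, forall z, sqmod (phi z) = 1}.
  apply: filterS2 et t1 => z /eqP; rewrite mulf_eq0 => /orP[|].
    by rewrite eq_complex /= eqxx andbT subr_eq0 => /eqP.
  by move=> /eqP ->; rewrite /sqmod /= expr0n addr0 => /esym/eqP; rewrite oner_eq0.
exists theta, (fun z => conjc (phi z) * theta z); split=> //.
  apply/is_innerP; split=> //; apply: filterS2 phi_unimodular t1 => z p1 t1.
  by rewrite sqmodM sqmodJ p1 t1 mulr1.
apply: filterS t1 => z t1.
by rewrite rmorphM /= conjcK mulrCA mul_conjc t1 mulr1.
Qed.

End extremal_vectors.

Unset Implicit Arguments.

Theorem theorem3p21 (R : realType) (u phi : circle R -> R[i])
    (u_inner : is_inner u) (u_nonconst : nonconstant u)
    (phi_Loo : Loo phi) (phi_norm : cLnorm +oo%E phi = 1%E) :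
  (exists psi chi : circle R -> R[i],
     [/\ is_inner psi, is_inner chi
       & aeeq phi (fun z => u z * psi z * conjc (chi z))])
  <->
  (exists y0 : circle R -> R[i],
     [/\ H2minus y0, ~ aeeq y0 (cst 0),
         extremal u phi (osum (cst 0) y0)
       & H2minus (fun z => phi z * conjc (u z) * y0 z)]).
Proof.
have mphi : cmeasurable phi := phi_Loo.1.
have phi1 := Loo_sqmod_le phi_norm.
have /is_innerP[Hu u1] := u_inner; have mu := L2_cmeasurable Hu.1.
have osum0 y : osum (cst 0) y = y by apply/funext => z; rewrite /osum add0r.
split=> [[psi [chi [ipsi ichi phiE]]]|[y [[Ly yH] y0 ext phiuy]]].
  have /is_innerP[Hpsi psi1] := ipsi; have /is_innerP[Hchi chi1] := ichi.
  have /is_innerP[Hup up1] := is_innerM u_inner ipsi.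
  have /is_innerP[Huc uc1] := is_innerM u_inner ichi.
  (* with this vector phi y = conj (z chi), and conj (u) phi y = conj (z u chi) *)
  pose y z := conjc (sval z * (u z * psi z)).
  have yE z : y z = conjc (sval z) * conjc (u z) * conjc (psi z).
    by rewrite /y !rmorphM /= mulrA.
  have y1 : {ae arclength R, forall z, sqmod (y z) = 1}.
    by apply: filterS up1 => z h; rewrite /y sqmodJ sqmodM sqmod_circle h mulr1.
  have Hy : H2minus y by exact: H2minus_of_H2.
  have phiy : aeeq (fun z => conjc (sval z * chi z)) (fun z => phi z * y z).
    apply: filterS3 phiE u1 psi1 => z -> u1 psi1; rewrite yE.
    transitivity (conjc (sval z) * conjc (chi z) * (u z * conjc (u z)) * (psi z * conjc (psi z))).
      by rewrite !mul_conjc u1 psi1 !mulr1 rmorphM.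
    by ring.
  have mphiy : cmeasurable (fun z => phi z * y z).
    by apply: cmeasurableM => //; exact: L2_cmeasurable Hy.1.
  have Hphiy : H2minus (fun z => phi z * y z).
    exact: closed_subspace_ae closed_H2minus (H2minus_of_H2 Hchi) mphiy phiy.
  have KH : model_space u `<=` @H2 R by move=> g [].
  exists y; split=> //.
  - move=> y0; apply: (@ae_constant R); apply: filterS2 y0 y1 => z ->.
    by rewrite /sqmod /= expr0n addr0 => /esym/eqP; rewrite oner_eq0.
  - rewrite osum0; split; first by split; [exact: Hy.1|move=> g /KH; exact: Hy.2].
    have KL : model_space u `<=` @L2 R by move=> g /KH[].
    have P0 := orth_proj_orthogonal KL Hphiy.1 (fun g Kg => Hphiy.2 _ (KH _ Kg)).
    have LD : L2 (dual_toeplitz u phi y).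
      by apply: L2B; [exact: Hphiy.1|exact: L2_orth_proj].
    rewrite (cLnorm2_sqnorm LD) (cLnorm2_sqnorm Hy.1); congr (_%:E `^ _)%E.
    apply: rintegral_ae.
    + by apply: measurable_sqmod; exact: L2_cmeasurable.
    + by apply: measurable_sqmod; exact: L2_cmeasurable Hy.1.
    apply: filterS3 P0 phiy (filterI chi1 y1) => z P0 e [c1 ->].
    by rewrite /dual_toeplitz P0 subr0 -e sqmodJ sqmodM sqmod_circle c1 mulr1.
  - apply: (closed_subspace_ae closed_H2minus (H2minus_of_H2 Huc)).
      apply: cmeasurableM; last exact: L2_cmeasurable Hy.1.
      by apply: cmeasurableM => //; exact: cmeasurableJ.
    apply: filterS phiy => z e.
    transitivity (conjc (u z) * conjc (sval z * chi z)); last by rewrite e; ring.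
    by rewrite !rmorphM /=; ring.
rewrite osum0 in ext.
have [phiK phimod] := extremal_contraction u_inner mphi phi1 Ly ext.
have Lphiy : L2 (fun z => phi z * y z) by exact: L2M.
have phiy : H2minus (fun z => phi z * y z).
  apply: (H2minus_of_orthogonal u_inner Lphiy phiK) => _ [g Hg <-].
  rewrite -[RHS](phiuy.2 _ Hg) !inner_prodE; congr cintegral; apply/funext => z.
  by rewrite rmorphM; ring.
pose w z := conjc (sval z * y z).
have Hw : H2 w by exact: H2_of_H2minus.
have [|||theta [chi [it ic e]]] := @inner_quotient R phi w mphi phi1 Hw.
- move=> w0; apply: y0; apply: filterS w0 => z /eqP.
  by rewrite conjc_eq0 mulf_eq0 (negbTE (circle_neq0 z)) /= => /eqP.
- have := H2_of_H2minus phiy; congr H2; apply/funext => z.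
  by rewrite /w !rmorphM; ring.
- by apply: filterS phimod => z; rewrite /w sqmodJ sqmodM sqmod_circle mul1r.
exists theta, (fun z => u z * chi z); split=> //; first exact: is_innerM.
apply: filterS2 e u1 => z -> u1.
transitivity ((u z * conjc (u z)) * (theta z * conjc (chi z))).
  by rewrite mul_conjc u1 mul1r.
by rewrite rmorphM; ring.
Qed.
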